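(* Let $\mathcal G\rightrightarrows M$ be a regular Lie groupoid equipped with a $0$-metric $\eta^{(0)}$. Then the metric $g^M:=\eta^{(0)}$ makes the orbit foliation $\mathcal O$ into a Riemannian foliation (i.e. $g^M$ is bundle-like for $\mathcal O$).
   Context: A Lie groupoid $\mathcal G\rightrightarrows M$ has a smooth Hausdorff object manifold $M$ and a smooth, possibly non-Hausdorff, arrow manifold $\mathcal G$; the source $s$ is a submersion with Hausdorff fibres; target $t$, units, inversion and multiplication are smooth. The orbit through $x$ is $O_x=t(s^{-1}(x))$. The Lie algebroid is $A_{\mathcal G}=\ker(ds)|_M$ (restricted to units) with anchor $\rho_{\mathcal G}=dt|_{A_{\mathcal G}}:A_{\mathcal G}\to TM$. $\mathcal G$ is regular if $\rho_{\mathcal G}$ has locally constant rank; then $T\mathcal O:=\operatorname{im}\rho_{\mathcal G}\subseteq TM$ is an involutive subbundle and defines the orbit foliation $\mathcal O$, whose leaves are the connected components of the orbits. For an orbit $O$ and an arrow $g:x\to y$ between points of $O$, the normal representation is $\lambda_g:\nu_x(O)\to\nu_y(O)$, $\nu(O)=TM|_O/TO$, $\lambda_g([v])=[dt_g(X)]$ for any $X\in T_g\mathcal G$ with $ds_g(X)=v$ (well defined). A $0$-metric is a Riemannian metric on $M$ such that for every orbit $O$ all $\lambda_g$ are isometries for the quotient metric on $\nu(O)$. A Riemannian metric on $M$ is bundle-like for a foliation $\mathcal F$ if the induced metric on the normal bundle $TM/T\mathcal F$ is invariant under holonomy (equivalently, under the local flows of vector fields tangent to $\mathcal F$); a foliation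 admitting a bundle-like metric is called Riemannian. *)

(* Defs.v *)
From HB Require Import structures.
From mathcomp Require Import all_boot all_order all_algebra.
From mathcomp Require Import all_classical all_reals all_analysis.

Set Implicit Arguments.
Unset Strict Implicit.
Unset Printing Implicit Defensive.

Import Order.TTheory GRing.Theory Num.Theory.
Import numFieldNormedType.Exports.

Local Open Scope classical_set_scope.
Local Open Scope ring_scope.

(* All functions below are total: charts, their inverses and the groupoid
   multiplication take junk values off the sets on which they are constrained. *)

(* U is meant to be open and V finite-dimensional: then f is of class C^k on U
   iff its iterated directional derivatives up to order k exist and are
   continuous on U. *)
Fixpoint Ck_on (R : realType) (V W : normedModType R) (k : nat)
    (U : set V) (f : V -> W) : Prop :=
  match k with
  | 0%N => forall x, U x -> {for x, continuous f}
  | k'.+1 => (forall x, U x -> differentiable f x) /\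
             (forall v, Ck_on k' U (fun x => 'D_v f x))
  end.

Definition smooth_on (R : realType) (V W : normedModType R)
    (U : set V) (f : V -> W) : Prop :=
  forall k, Ck_on k U f.

Record chart (R : realType) (X : topologicalType) (n : nat) := Chart {
  chart_dom : set X;
  chart_map :> X -> 'rV[R]_n;
  chart_inv : 'rV[R]_n -> X;
  chart_dom_open : open chart_dom;
  chart_cod_open : open (chart_map @` chart_dom);
  chart_mapK : forall x, chart_dom x -> chart_inv (chart_map x) = x;
  chart_map_continuous : forall x, chart_dom x -> {for x, continuous chart_map};
  chart_inv_continuous :
    forall p, (chart_map @` chart_dom) p -> {for p, continuous chart_inv} }.

Definition chart_cod (R : realType) (X : topologicalType) (n : nat)
    (c : chart R X n) : set 'rV[R]_n := c @` chart_dom c.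

Definition smooth_transition (R : realType) (X : topologicalType) (n : nat)
    (c c' : chart R X n) : Prop :=
  smooth_on (c @` (chart_dom c `&` chart_dom c')) (c' \o chart_inv c).

(* Neither Hausdorff nor second countable in general. *)
Record manifold (R : realType) (n : nat) := Manifold {
  manifold_space :> topologicalType;
  atlas : set (chart R manifold_space n);
  atlas_cover : forall x, exists2 c, atlas c & chart_dom c x;
  atlas_smooth : forall c c', atlas c -> atlas c' -> smooth_transition c c' }.

Definition chart_at (R : realType) (n : nat) (M : manifold R n) (x : M) :
    chart R M n :=
  s2val (cid2 (atlas_cover x)).

Definition compatible_chart (R : realType) (n : nat) (M : manifold R n)
    (c : chart R M n) : Prop :=
  forall c', atlas c' -> smooth_transition c c' /\ smooth_transition c' c.

Definition smooth_map (R : realType) (m n : nat)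
    (M : manifold R m) (N : manifold R n) (f : M -> N) : Prop :=
  continuous f /\
  forall (c : chart R M m) (c' : chart R N n), atlas c -> atlas c' ->
    smooth_on (c @` (chart_dom c `&` f @^-1` chart_dom c'))
              (c' \o f \o chart_inv c).

(* A tangent vector at x is given by its coordinates in the preferred chart
   [chart_at x]. *)
Definition tangent (R : realType) (n : nat) (M : manifold R n) (x : M) : Type :=
  'rV[R]_n.

Definition tdiff (R : realType) (m n : nat) (M : manifold R m)
    (N : manifold R n) (f : M -> N) (x : M) (v : tangent x) : tangent (f x) :=
  'd (chart_at (f x) \o f \o chart_inv (chart_at x)) (chart_at x x) v.

(* The matrix of [tdiff f x], acting on row vectors from the right. *)
Definition tdiff_mx (R : realType) (m n : nat) (M : manifold R m)
    (N : manifold R n) (f : M -> N) (x : M) : 'M[R]_(m, n) :=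
  'J (chart_at (f x) \o f \o chart_inv (chart_at x)) (chart_at x x).

Definition to_coord (R : realType) (n : nat) (M : manifold R n)
    (c : chart R M n) (x : M) (v : tangent x) : 'rV[R]_n :=
  'd (c \o chart_inv (chart_at x)) (chart_at x x) v.

Definition of_coord (R : realType) (n : nat) (M : manifold R n)
    (c : chart R M n) (x : M) (u : 'rV[R]_n) : tangent x :=
  'd (chart_at x \o chart_inv c) (c x) u.

Definition submersion (R : realType) (m n : nat) (M : manifold R m)
    (N : manifold R n) (f : M -> N) : Prop :=
  forall (x : M) (v : tangent (f x)), exists u : tangent x, tdiff f u = v.

(* [mul g h], for src g = tgt h, is the composite "g after h". *)
Record groupoid (Ob Ar : Type) := Groupoid {
  src : Ar -> Ob;
  tgt : Ar -> Ob;
  unit_arrow : Ob -> Ar;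
  inv_arrow : Ar -> Ar;
  mul : Ar -> Ar -> Ar;
  src_unit : forall x, src (unit_arrow x) = x;
  tgt_unit : forall x, tgt (unit_arrow x) = x;
  src_inv : forall g, src (inv_arrow g) = tgt g;
  tgt_inv : forall g, tgt (inv_arrow g) = src g;
  src_mul : forall g h, src g = tgt h -> src (mul g h) = src h;
  tgt_mul : forall g h, src g = tgt h -> tgt (mul g h) = tgt g;
  mulA : forall g h k, src g = tgt h -> src h = tgt k ->
    mul g (mul h k) = mul (mul g h) k;
  mul_unitl : forall g, mul (unit_arrow (tgt g)) g = g;
  mul_unitr : forall g, mul g (unit_arrow (src g)) = g;
  mul_invl : forall g, mul (inv_arrow g) g = unit_arrow (src g);
  mul_invr : forall g, mul g (inv_arrow g) = unit_arrow (tgt g) }.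

(* Smoothness of the multiplication on the embedded submanifold
   { (g, h) | src g = tgt h } of the product: in charts, it locally extends to a
   smooth map on an open subset of R^m x R^m. *)
Definition smooth_mul (R : realType) (n m : nat) (M : manifold R n)
    (G : manifold R m) (gr : groupoid M G) : Prop :=
  forall g h : G, src gr g = tgt gr h ->
  exists (c1 c2 c3 : chart R G m) (W : set ('rV[R]_m * 'rV[R]_m)%type)
         (F : ('rV[R]_m * 'rV[R]_m)%type -> 'rV[R]_m),
  [/\ [/\ atlas c1, atlas c2 & atlas c3],
      chart_dom c1 g /\ chart_dom c2 h,
      open W /\ W (c1 g, c2 h),
      smooth_on W F &
      forall g' h' : G, chart_dom c1 g' -> chart_dom c2 h' ->
        src gr g' = tgt gr h' -> W (c1 g', c2 h') ->
        chart_dom c3 (mul gr g' h') /\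
        c3 (mul gr g' h') = F (c1 g', c2 h')].

(* [set_type A] carries the subspace topology. *)
Record lie_groupoid (R : realType) (n m : nat) (M : manifold R n)
    (G : manifold R m) := LieGroupoid {
  lie_gr :> groupoid M G;
  objects_hausdorff : hausdorff_space M;
  src_fibre_hausdorff : forall x : M,
    hausdorff_space (set_type [set g : G | src lie_gr g = x]);
  src_smooth : smooth_map (src lie_gr);
  src_submersion : submersion (src lie_gr);
  tgt_smooth : smooth_map (tgt lie_gr);
  unit_smooth : smooth_map (unit_arrow lie_gr);
  inv_smooth : smooth_map (inv_arrow lie_gr);
  mul_smooth : smooth_mul lie_gr }.

Definition orbit (R : realType) (n m : nat) (M : manifold R n)
    (G : manifold R m) (gr : lie_groupoid M G) (x : M) : set M :=
  tgt gr @` [set g | src gr g = x].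

(* The fibre at x of the Lie algebroid. *)
Definition algebroid (R : realType) (n m : nat) (M : manifold R n)
    (G : manifold R m) (gr : lie_groupoid M G) (x : M) :
    set (tangent (unit_arrow gr x)) :=
  [set a | tdiff (src gr) a = 0 :> 'rV[R]_n].
Arguments algebroid {R n m M G} gr x.

(* [tdiff (tgt gr) a] is tangent at [tgt gr (unit_arrow gr x)], which is x. *)
Definition anchor (R : realType) (n m : nat) (M : manifold R n)
    (G : manifold R m) (gr : lie_groupoid M G) (x : M)
    (a : tangent (unit_arrow gr x)) : tangent x :=
  tdiff (tgt gr) a.
Arguments anchor {R n m M G} gr x a.

Definition tangent_distribution (R : realType) (n : nat) (M : manifold R n) : Type :=
  forall x : M, set (tangent x).

(* The image of the anchor: at x it is the tangent space at x of the orbit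
   through x, and for regular groupoids the tangent bundle of the orbit
   foliation. *)
Definition orbit_tangent (R : realType) (n m : nat) (M : manifold R n)
    (G : manifold R m) (gr : lie_groupoid M G) : tangent_distribution M :=
  fun x => anchor gr x @` algebroid gr x.
Arguments orbit_tangent {R n m M G} gr.

Definition anchor_rank (R : realType) (n m : nat) (M : manifold R n)
    (G : manifold R m) (gr : lie_groupoid M G) (x : M) : nat :=
  \rank (kermx (tdiff_mx (src gr) (unit_arrow gr x)) *m
         tdiff_mx (tgt gr) (unit_arrow gr x)).

Definition regular (R : realType) (n m : nat) (M : manifold R n)
    (G : manifold R m) (gr : lie_groupoid M G) : Prop :=
  forall x : M, \forall y \near x, anchor_rank gr y = anchor_rank gr x.

Record riemannian_metric (R : realType) (n : nat) (M : manifold R n) :=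
  RiemannianMetric {
  metric :> forall x : M, tangent x -> tangent x -> R;
  metric_sym : forall (x : M) (v w : tangent x), metric v w = metric w v;
  metric_linear : forall (x : M) (a : R) (u v w : 'rV[R]_n),
    @metric x (a *: u + v) w = a * @metric x u w + @metric x v w;
  metric_pos : forall (x : M) (v : 'rV[R]_n), v != 0 -> 0 < @metric x v v;
  metric_smooth : forall (c : chart R M n) (u v : 'rV[R]_n), atlas c ->
    smooth_on (W := R^o) (chart_cod c)
      (fun p => metric (of_coord c (chart_inv c p) u)
                       (of_coord c (chart_inv c p) v)) }.

(* The component of v orthogonal to D x. *)
Definition normal_part (R : realType) (n : nat) (M : manifold R n)
    (D : tangent_distribution M) (eta : riemannian_metric M) (x : M) (v : tangent x) :
    tangent x :=
  xget (0 : 'rV[R]_n)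
    [set w : 'rV[R]_n | D x ((v : 'rV[R]_n) - w) /\
       forall u, D x u -> @metric _ _ _ eta x w u = 0].

(* The metric induced by eta on the normal bundle TM / D, evaluated on the
   classes of v and w. *)
Definition quotient_metric (R : realType) (n : nat) (M : manifold R n)
    (D : tangent_distribution M) (eta : riemannian_metric M) (x : M)
    (v w : tangent x) : R :=
  eta x (normal_part D eta v) (normal_part D eta w).

(* Linear maps TM/D|_x -> TM/D|_y are represented by the relation they induce on
   representatives in the tangent spaces of M at x and y. *)
Definition normal_isometry (R : realType) (n : nat) (M : manifold R n)
    (D : tangent_distribution M) (eta : riemannian_metric M) (x y : M)
    (L : tangent x -> tangent y -> Prop) : Prop :=
  forall (v v' : tangent x) (w w' : tangent y), L v w -> L v' w' ->
    quotient_metric D eta w w' = quotient_metric D eta v v'.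

Definition normal_rep (R : realType) (n m : nat) (M : manifold R n)
    (G : manifold R m) (gr : lie_groupoid M G) (g : G)
    (v : tangent (src gr g)) (w : tangent (tgt gr g)) : Prop :=
  exists X : tangent g, tdiff (src gr) X = v :> 'rV[R]_n /\
    orbit_tangent gr (tgt gr g) ((w : 'rV[R]_n) - tdiff (tgt gr) X).
Arguments normal_rep {R n m M G} gr g v w.

Definition zero_metric (R : realType) (n m : nat) (M : manifold R n)
    (G : manifold R m) (gr : lie_groupoid M G) (eta : riemannian_metric M) :
    Prop :=
  forall (x0 : M) (g : G),
    orbit gr x0 (src gr g) -> orbit gr x0 (tgt gr g) ->
    normal_isometry (orbit_tangent gr) eta (normal_rep gr g).

(* A cubic chart (balls of 'rV are open cubes) in which D is spanned by the first
   p coordinate fields; its plaques are the slices on which the coordinates of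
   index >= p are constant. *)
Definition foliated_chart (R : realType) (n : nat) (M : manifold R n)
    (D : tangent_distribution M) (p : nat) (c : chart R M n) : Prop :=
  [/\ compatible_chart c,
      exists (a : 'rV[R]_n) (r : R), chart_cod c = ball a r &
      forall x : M, chart_dom c x -> forall v : tangent x,
        D x v <-> (forall i : 'I_n, (p <= i)%N -> to_coord c v ord0 i = 0)].

(* [holonomy D L]: L is the linear holonomy TM/D|_x -> TM/D|_y along some leafwise
   path from x to y, that is, along a chain of plaques. Inside one plaque, it is
   the identification given by the transverse coordinates. *)
Inductive holonomy (R : realType) (n : nat) (M : manifold R n)
    (D : tangent_distribution M) :
    forall x y : M, (tangent x -> tangent y -> Prop) -> Prop :=
| holonomy_plaque (p : nat) (c : chart R M n) (x y : M) :
    foliated_chart D p c -> chart_dom c x -> chart_dom c y ->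
    (forall i : 'I_n, (p <= i)%N -> c x ord0 i = c y ord0 i) ->
    holonomy D (fun (v : tangent x) (w : tangent y) =>
      forall i : 'I_n, (p <= i)%N ->
        to_coord c v ord0 i = to_coord c w ord0 i)
| holonomy_comp (x y z : M) (K : tangent x -> tangent y -> Prop)
    (L : tangent y -> tangent z -> Prop) :
    holonomy D K -> holonomy D L ->
    holonomy D (fun v w => exists2 u, K v u & L u w).

(* Here a foliation is given by its tangent bundle D. *)
Definition bundle_like (R : realType) (n : nat) (M : manifold R n)
    (D : tangent_distribution M) (eta : riemannian_metric M) : Prop :=
  forall (x y : M) (L : tangent x -> tangent y -> Prop),
    holonomy D L -> normal_isometry D eta L.

(* Main.v *)
From HB Require Import structures.
Require Import Defs.
From mathcomp Require Import all_boot all_order all_algebra.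
From mathcomp Require Import all_classical all_reals all_analysis.
From mathcomp Require Import ring lra.

(** Fix a foliated chart. Its plaques are the slices on which the transverse
    coordinates are constant, and inside one plaque the linear holonomy is the
    identification of normal vectors that have the same transverse coordinates.
    The theorem holds because between nearby points this identification is the
    normal representation of an arrow close to a unit, and 0-metrics make normal
    representations isometric.

    The point is that the source and the target of an arrow close to a unit
    have the same transverse coordinates ([src_tgt_transverse]). Right
    translation by the inverse of g carries the source fibre through g to the
    one through the unit at the target of g and does not change targets. So the
    differential of the target map sends vectors tangent to the source fibres to
    vectors tangent to the orbits ([tgt_ker_src]), and these have vanishing
    transverse coordinates. Therefore the difference between the transverse
    coordinates of target and source is constant along source fibres near the
    unit ([const_on_fibres]), and it vanishes on units. Differentiating the
    resulting identity says that the normal representation of g preserves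
    transverse coordinates ([arrow_isometry]).

    Conversely, at a unit over z the source map and the leafwise coordinates of
    the target map have together a surjective differential, by the definition
    of the orbit tangent spaces. So all points of the plaque of z that are close
    to z are targets of such arrows starting at z ([plaque_arrow]). Hence the
    normal metric, expressed in transverse coordinates, is locally constant
    along the segment between two points of a plaque, which lies in the chart
    because charts are cubes, and so it is constant ([plaque_isometry]).
    Holonomy along chains of plaques follows by composition.

    Both steps rest on an implicit function theorem. For a map with a strict
    derivative A at a point and a right inverse B of A, the equation
    f (g + w *m B) = y is solved for w by a contraction ([strict_diff_solve]),
    and w is Lipschitz in g and y ([strict_diff_implicit_le]). Lipschitz
    dependence suffices to differentiate along the fibres of f: a smooth inverse
    function is never constructed. *)

Set Implicit Arguments.
Unset Strict Implicit.
Unset Printing Implicit Defensive.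

Import Order.TTheory GRing.Theory Num.Theory.
Import numFieldNormedType.Exports.

Local Open Scope classical_set_scope.
Local Open Scope ring_scope.

(** * Matrices *)

Lemma mxBE (R : zmodType) m n (A B : 'M[R]_(m, n)) i j :
  (A - B) i j = A i j - B i j.
Proof. by rewrite !mxE. Qed.

Lemma surjective_right_inverse (F : fieldType) m n (A : 'M[F]_(m, n)) :
  (forall v : 'rV_n, exists u : 'rV_m, u *m A = v) ->
  exists B, B *m A = 1%:M.
Proof.
move=> sA; exists (pinvmx A); apply: mulVpmx.
rewrite -sub1mx; apply/row_subP => i.
by have [u <-] := sA (row i 1%:M); exact: submxMl.
Qed.

(** With a right inverse B of A, every v differs from v *m A *m B by an element
    of the kernel of A, so that a matrix killing this kernel only sees v *m A. *)
Lemma kernel_factor (F : fieldType) m n k (A : 'M[F]_(m, n))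
    (H : 'M[F]_(m, k)) B :
  B *m A = 1%:M -> (forall v : 'rV_m, v *m A = 0 -> v *m H = 0) ->
  exists N, H = A *m N.
Proof.
move=> BA AH; exists (B *m H).
suff H0 : (1%:M - A *m B) *m H = 0.
  by apply/eqP; rewrite mulmxA -subr_eq0 -[X in X - _]mul1mx -mulmxBl H0.
apply/row_matrixP => i; rewrite row_mul row0; apply: AH.
by rewrite -row_mul mulmxBl mul1mx -mulmxA BA mulmx1 subrr row0.
Qed.

Lemma mulmx_sub_ker (F : fieldType) m n k (v : 'rV[F]_m) (S T : 'M[F]_(m, n))
    (P : 'M[F]_(n, k)) :
  v *m S = 0 -> v *m T *m P = 0 -> v *m ((T - S) *m P) = 0.
Proof. by move=> vS vT; rewrite mulmxA mulmxBr vS subr0. Qed.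

Lemma mulmx_row_eq (F : fieldType) m n k (v : 'rV[F]_m) (S T : 'M[F]_(m, n))
    (P : 'M[F]_(n, k)) :
  S *m P = T *m P -> v *m S *m P = v *m T *m P.
Proof. by move=> ST; rewrite -!mulmxA ST. Qed.

Lemma norm_coord_le (R : realType) m n (v : 'M[R]_(m, n)) i j : `|v i j| <= `|v|.
Proof.
rewrite [leRHS]/Num.Def.normr/= mx_normrE.
exact: (le_bigmax _ (fun ij : 'I_m * 'I_n => `|v ij.1 ij.2|) (i, j)).
Qed.

Lemma norm_mx_le (R : realType) m n (v : 'M[R]_(m, n)) (e : R) : 0 <= e ->
  (forall i j, `|v i j| <= e) -> `|v| <= e.
Proof.
move=> e0 H; rewrite [leLHS]/Num.Def.normr/= mx_normrE.
by apply: bigmax_le => // -[i j] _.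
Qed.

Lemma mulmx_norm_le (R : realType) m n (A : 'M[R]_(m, n)) (e : R) (v : 'rV[R]_m) :
  (forall i j, `|A i j| <= e) -> 0 <= e -> `|v *m A| <= m%:R * e * `|v|.
Proof.
move=> Ae e0; apply: norm_mx_le => [|i j].
  by rewrite !mulr_ge0// ler0n.
rewrite mxE (le_trans (ler_norm_sum _ _ _))//.
apply: (@le_trans _ _ (\sum_(k < m) e * `|v|)); last first.
  by rewrite sumr_const card_ord -[_ *+ m]mulr_natl mulrA.
by apply: ler_sum => k _; rewrite normrM mulrC ler_pM// norm_coord_le.
Qed.

Lemma mulmx_bounded (R : realType) m n (A : 'M[R]_(m, n)) :
  exists2 C : R, 0 < C & forall v : 'rV[R]_m, `|v *m A| <= C * `|v|.
Proof.
exists (m%:R * `|A| + 1) => [|v].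
  by rewrite ltr_wpDl// mulr_ge0// ler0n.
rewrite (@le_trans _ _ (m%:R * `|A| * `|v|))//.
  by apply: mulmx_norm_le => // i j; exact: norm_coord_le.
by rewrite ler_wpM2r// lerDl.
Qed.

(** * Strict differentiability *)

(** The increment bound is required for all pairs of points near a, not only
    for pairs containing a. This is what the contraction argument needs, and a
    C^1 map satisfies it. *)
Definition strict_diff (R : realType) m n (f : 'rV[R]_m -> 'rV[R]_n)
    (a : 'rV[R]_m) (A : 'M[R]_(m, n)) : Prop :=
  forall e : R, 0 < e -> exists2 d : R, 0 < d & forall x y,
    `|x - a| < d -> `|y - a| < d -> `|f x - f y - (x - y) *m A| <= e * `|x - y|.

Lemma near_radius (R : realType) (V : normedModType R) (a : V) (P : V -> Prop) :
  (\forall x \near a, P x) <->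
  exists2 d : R, 0 < d & forall x, `|x - a| < d -> P x.
Proof.
split.
  move=> /nbhs_ballP[d /= d0 H]; exists d => // x xa.
  by apply: H; rewrite -ball_normE /= distrC.
move=> [d d0 H]; apply/nbhs_ballP; exists d => //= x.
by rewrite -ball_normE /= distrC; exact: H.
Qed.

Lemma radius_forall (R : realType) (V : normedModType R) (a : V) (I : finType)
    (P : I -> V -> Prop) :
  (forall i, exists2 d : R, 0 < d & forall x, `|x - a| < d -> P i x) ->
  exists2 d : R, 0 < d & forall x, `|x - a| < d -> forall i, P i x.
Proof.
move=> H; apply/(near_radius a (fun x => forall i, P i x)).
by apply: filter_forall => i; apply/near_radius.
Qed.

Lemma jacobianE (R : realType) m n (f : 'rV[R]_m -> 'rV[R]_n) a v :
  'd f a v = v *m 'J f a.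
Proof. by rewrite /jacobian mul_rV_lin1. Qed.

(** Differentiability with derivative A, in the form used for estimates. *)
Definition has_jacobian (R : realType) m n (f : 'rV[R]_m -> 'rV[R]_n)
    (a : 'rV[R]_m) (A : 'M[R]_(m, n)) : Prop :=
  forall e : R, 0 < e -> exists2 d : R, 0 < d & forall x,
    `|x - a| < d -> `|f x - f a - (x - a) *m A| <= e * `|x - a|.

Lemma has_jacobian_diff (R : realType) m n (f : 'rV[R]_m -> 'rV[R]_n) a :
  differentiable f a -> has_jacobian f a ('J f a).
Proof.
move=> df e e0; apply/near_radius.
have /diff_locally := df => /eqaddoP /(_ e e0) /near_radius[d d0 H].
apply/near_radius; exists d => // x xa.
have := H (x - a); rewrite subr0 => /(_ xa).
rewrite (_ : (_ - _ : _ -> _) (x - a) =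
  f (x - a + a) - (f a + 'd f a (x - a)))// subrK -jacobianE opprD addrA.
exact.
Qed.

Lemma strict_diff_eq (R : realType) m n (f g : 'rV[R]_m -> 'rV[R]_n) a A :
  {near a, f =1 g} -> strict_diff f a A -> strict_diff g a A.
Proof.
move=> /near_radius[d1 d10 fg] fA e /fA [d d0 H].
exists (Num.min d d1) => [|x y]; first by rewrite lt_min d0.
rewrite !lt_min => /andP[xd xd1] /andP[yd yd1].
by rewrite -!fg//; exact: H.
Qed.

Lemma strict_diff_lip (R : realType) m n (f : 'rV[R]_m -> 'rV[R]_n) a A :
  strict_diff f a A -> exists2 C : R, 0 < C & exists2 d : R, 0 < d &
   forall x y, `|x - a| < d -> `|y - a| < d -> `|f x - f y| <= C * `|x - y|.
Proof.
move=> fA; have [C C0 HC] := mulmx_bounded A.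
have [d d0 H] := fA 1 ltr01.
exists (1 + C); first by rewrite addr_gt0.
exists d => // x y xd yd.
rewrite -(subrK ((x - y) *m A) (f x - f y)) mulrDl.
by rewrite (le_trans (ler_normD _ _))// lerD// H.
Qed.

Lemma strict_diff_comp (R : realType) m n k (f : 'rV[R]_m -> 'rV[R]_n)
    (g : 'rV[R]_n -> 'rV[R]_k) a A B :
  strict_diff f a A -> strict_diff g (f a) B -> strict_diff (g \o f) a (A *m B).
Proof.
move=> fA gB e e0.
have [C C0 HC] := mulmx_bounded B.
have [L L0 [d1 d10 H1]] := strict_diff_lip fA.
have [d2 d20 H2] := gB (e / 2 / L) ltac:(by rewrite !divr_gt0).
have [d3 d30 H3] := fA (e / 2 / C) ltac:(by rewrite !divr_gt0).
exists (Num.min d1 (Num.min d3 (d2 / L))) => [|x y].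
  by rewrite !lt_min d10 d30 divr_gt0.
rewrite !lt_min => /and3P[x1 x3 xL] /and3P[y1 y3 yL].
have fd z : `|z - a| < d1 -> `|z - a| < d2 / L -> `|f z - f a| < d2.
  move=> z1 zL; rewrite (le_lt_trans (H1 _ _ z1 _))//; first by rewrite subrr normr0.
  by rewrite mulrC -ltr_pdivlMr.
have G := H2 (f x) (f y) (fd _ x1 xL) (fd _ y1 yL).
have F := H3 x y x3 y3.
have -> : (g \o f) x - (g \o f) y - (x - y) *m (A *m B) =
   (g (f x) - g (f y) - (f x - f y) *m B) + (f x - f y - (x - y) *m A) *m B.
  by rewrite /= (mulmxBl (f x - f y)) mulmxA addrA subrK.
rewrite (le_trans (ler_normD _ _))// (splitr e) mulrDl lerD//.
  rewrite (le_trans G)// -mulrA ler_wpM2l//; first by rewrite divr_ge0// ltW.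
  by rewrite ler_pdivrMl// H1.
rewrite (le_trans (HC _))//.
by rewrite mulrC -ler_pdivlMr// mulrAC.
Qed.

Lemma strict_diff_mulmx (R : realType) m n (B : 'M[R]_(m, n)) a :
  strict_diff (fun x => x *m B) a B.
Proof.
move=> e e0; exists 1 => // x y _ _.
by rewrite -mulmxBl subrr normr0 mulr_ge0// ltW.
Qed.

(** The norm is the sup norm, so the bounds for the two blocks combine without
    loss. *)
Lemma strict_diff_row_mx (R : realType) m n k (f : 'rV[R]_m -> 'rV[R]_n)
    (g : 'rV[R]_m -> 'rV[R]_k) a A B :
  strict_diff f a A -> strict_diff g a B ->
  strict_diff (fun x => row_mx (f x) (g x)) a (row_mx A B).
Proof.
move=> fA gB e e0.
have [d1 d10 H1] := fA e e0; have [d2 d20 H2] := gB e e0.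
exists (Num.min d1 d2) => [|x y]; first by rewrite lt_min d10.
rewrite !lt_min => /andP[x1 x2] /andP[y1 y2].
rewrite mul_mx_row !opp_row_mx !add_row_mx.
apply: norm_mx_le => [|i j]; first by rewrite mulr_ge0// ltW.
case: (split_ordP j) => l ->; rewrite ?row_mxEl ?row_mxEr.
  exact: le_trans (norm_coord_le _ _ _) (H1 _ _ x1 y1).
exact: le_trans (norm_coord_le _ _ _) (H2 _ _ x2 y2).
Qed.

(** Uniqueness of the differential: the radius estimates determine it. *)
Lemma bounded_linear_diff (R : realType) (V W : normedModType R) (f : V -> W)
    (L : {linear V -> W}) (a : V) (C : R) :
  0 < C -> (forall x, `|L x| <= C * `|x|) ->
  (forall e : R, 0 < e -> exists2 d : R, 0 < d & forall x, `|x - a| < d ->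
     `|f x - f a - L (x - a)| <= e * `|x - a|) ->
  differentiable f a /\ 'd f a = L :> (V -> W).
Proof.
move=> C0 LC fL.
have cL : continuous L.
  move=> x; apply/cvgrPdist_lt => e e0; apply/near_radius.
  exists (e / C) => [|y yx]; first by rewrite divr_gt0.
  by rewrite -linearB (le_lt_trans (LC _))// mulrC -ltr_pdivlMr// distrC.
have E : f \o shift a = cst (f a) + L +o_ 0 id.
  apply/eqaddoP => e /fL[d d0 H].
  suff : \forall x \near (0 : V),
      `|(f \o shift a - (cst (f a) + L)) x| <= e * `|x| by [].
  apply/near_radius; exists d => // x; rewrite subr0 => xd.
  have := H (x + a); rewrite addrK => /(_ xd).
  rewrite (_ : (_ - _ : _ -> _) x = f (x + a) - (f a + L x))//.
  by rewrite opprD addrA.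
have dE := diff_unique cL E.
by split=> //; apply/diff_locallyP; rewrite dE.
Qed.

Lemma has_jacobianP (R : realType) m n (f : 'rV[R]_m -> 'rV[R]_n) a A :
  has_jacobian f a A -> differentiable f a /\ 'J f a = A.
Proof.
have [b b0 Ab] := mulmx_bounded A.
move=> /(bounded_linear_diff (L := mulmxr A) b0 Ab)[df dE]; split=> //.
by apply/row_matrixP => i; rewrite !rowE -jacobianE dE.
Qed.

Lemma strict_diff_has_jacobian (R : realType) m n (f : 'rV[R]_m -> 'rV[R]_n) a A :
  strict_diff f a A -> has_jacobian f a A.
Proof.
move=> fA e /fA[d d0 H]; exists d => // x xd; apply: H => //.
by rewrite subrr normr0.
Qed.

Lemma strict_diff_jacobian (R : realType) m n (f : 'rV[R]_m -> 'rV[R]_n) a A :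
  strict_diff f a A -> 'J f a = A.
Proof. by move=> /strict_diff_has_jacobian/has_jacobianP[]. Qed.

Lemma strict_diff_unique (R : realType) m n (f : 'rV[R]_m -> 'rV[R]_n) a A B :
  strict_diff f a A -> strict_diff f a B -> A = B.
Proof. by move=> /strict_diff_jacobian <- /strict_diff_jacobian <-. Qed.

Lemma has_jacobian_comp (R : realType) m n k (f : 'rV[R]_m -> 'rV[R]_n)
    (g : 'rV[R]_n -> 'rV[R]_k) a A B :
  has_jacobian f a A -> has_jacobian g (f a) B -> has_jacobian (g \o f) a (A *m B).
Proof.
move=> /has_jacobianP[df <-] /has_jacobianP[dg <-].
have -> : 'J f a *m 'J g (f a) = 'J (g \o f) a.
  apply/row_matrixP => i; rewrite !rowE mulmxA -!jacobianE.
  by rewrite (diff_comp df dg).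
by apply: has_jacobian_diff; exact: differentiable_comp.
Qed.

Lemma has_jacobianB (R : realType) m n (f g : 'rV[R]_m -> 'rV[R]_n) a A B :
  has_jacobian f a A -> has_jacobian g a B ->
  has_jacobian (fun x => f x - g x) a (A - B).
Proof.
move=> fA gB e e0; have e2 : 0 < e / 2 by rewrite divr_gt0.
have [d1 d10 H1] := fA _ e2; have [d2 d20 H2] := gB _ e2.
exists (Num.min d1 d2) => [|x]; first by rewrite lt_min d10.
rewrite lt_min => /andP[/H1 {}H1 /H2 {}H2].
have -> : f x - g x - (f a - g a) - (x - a) *m (A - B) =
    (f x - f a - (x - a) *m A) - (g x - g a - (x - a) *m B).
  by rewrite mulmxBr; apply/rowP => i; rewrite !mxBE; ring.
rewrite (le_trans (ler_normB _ _))//; move: H1 H2; lra.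
Qed.

(** * Smooth maps are strictly differentiable *)

Lemma is_derive_radius (R : realType) (phi : R -> R) (t l : R) :
  (forall e : R, 0 < e -> exists2 d : R, 0 < d & forall s, `|s - t| < d ->
     `|phi s - phi t - (s - t) * l| <= e * `|s - t|) ->
  is_derive t 1 phi l.
Proof.
move=> H.
have cv : h^-1 *: (phi (h *: 1 + t) - phi t) @[h --> 0^'] --> l.
  apply/cvgrPdist_le => e /H[d d0 {}H].
  near=> h.
  have h0 : h != 0 by near: h; exact: nbhs_dnbhs_neq.
  have hd : `|h| < d by near: h; exact: dnbhs0_lt.
  have := H (h + t); rewrite addrK => /(_ hd); rewrite [h *: 1]mulr1 => K.
  rewrite -(ler_pM2l (_ : 0 < `|h|)) ?normr_gt0// -normrM mulrBr.
  by rewrite -[_ *: _]/(_ * _) mulVKf// distrC [`|h| * e]mulrC.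
split; last exact/cvg_lim.
by apply/cvg_ex; exists l.
Unshelve. all: by end_near. Qed.

(** The hypothesis says that the derivative of phi exists and vanishes
    everywhere. It is stated by estimates because phi will be built from paths
    that are only Lipschitz. *)
Lemma const_of_small (R : realType) (phi : R -> R) :
  (forall t (e : R), 0 < e -> exists2 d : R, 0 < d & forall s, `|s - t| < d ->
     `|phi s - phi t| <= e * `|s - t|) ->
  forall s t, phi s = phi t.
Proof.
move=> H s t; apply: is_derive_0_is_cst => u; apply: is_derive_radius => e e0.
by have [d d0 {}H] := H u e e0; exists d => // v vd; rewrite mulr0 subr0 H.
Qed.

Lemma is_derive_line (R : realType) m n (f : 'rV[R]_m -> 'rV[R]_n) y v (t : R) j :
  differentiable f (y + t *: v) ->
  is_derive t 1 (fun s => f (y + s *: v) 0 j) ((v *m 'J f (y + t *: v)) 0 j).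
Proof.
move=> df; apply: is_derive_radius => e e0.
have vp : 0 < `|v| + 1 by rewrite ltr_wpDl.
have [d d0 H] := has_jacobian_diff df (divr_gt0 e0 vp).
exists (d / (`|v| + 1)) => [|s st]; first by rewrite divr_gt0.
have svE : (y + s *: v) - (y + t *: v) = (s - t) *: v.
  by rewrite opprD addrACA subrr add0r -scalerBl.
have := H (y + s *: v); rewrite svE normrZ => /(_ _) K.
have /K {}K : `|s - t| * `|v| < d.
  rewrite ltr_pdivlMr// in st; apply: le_lt_trans st.
  by rewrite ler_wpM2l// lerDl.
have := norm_coord_le (f (y + s *: v) - f (y + t *: v) -
   ((s - t) *: v) *m 'J f (y + t *: v)) 0 j.
move=> /le_trans /(_ K); rewrite -scalemxAl !mxE => /le_trans; apply.
rewrite -mulrA (ler_wpM2l (ltW e0))// mulrC ler_pdivrMr//.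
by rewrite ler_wpM2l// lerDl.
Qed.

Lemma segment_in_ball (R : realType) n (a x y : 'rV[R]_n) (d t : R) :
  `|x - a| < d -> `|y - a| < d -> 0 <= t <= 1 -> `|y + t *: (x - y) - a| < d.
Proof.
move=> xd yd /andP[t0 t1].
have -> : y + t *: (x - y) - a = t *: (x - a) + (1 - t) *: (y - a).
  by apply/rowP => i; rewrite !mxE; ring.
rewrite (le_lt_trans (ler_normD _ _))// !normrZ (ger0_norm t0) ger0_norm ?subr_ge0//.
have [->|tn1] := eqVneq t 1; first by rewrite subrr mul0r addr0 mul1r.
have : t * `|x - a| <= t * d by rewrite ler_wpM2l// ltW.
have : (1 - t) * `|y - a| < (1 - t) * d.
  by rewrite ltr_pM2l// subr_gt0 lt_neqAle tn1.
lra.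
Qed.

(** Mean value theorem, one coordinate at a time, on the segment between the
    two points: the derivative of f along it differs from that at a by as little
    as the partial derivatives do. *)
Lemma smooth_strict_diff (R : realType) m n (U : set 'rV[R]_m)
    (f : 'rV[R]_m -> 'rV[R]_n) a :
  open U -> U a -> smooth_on U f -> strict_diff f a ('J f a).
Proof.
move=> oU Ua /(_ 1%N)[df cf] e e0.
pose e' := e / (m%:R + 1).
have m1 : 0 < m%:R + 1 :> R by rewrite ltr_wpDl// ler0n.
have e'0 : 0 < e' by rewrite divr_gt0.
have nU : \forall x \near a, U x by exact: open_nbhs_nbhs.
have JE x i j : U x -> 'J f x i j = 'D_(delta_mx 0 i) f x 0 j.
  by move=> /df Dx; rewrite deriveEjacobian// -rowE [RHS]mxE.
have [d1 d10 H1] := (near_radius _ _).1 nU.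
have [d2 d20 H2] : exists2 d : R, 0 < d & forall x, `|x - a| < d ->
    forall i, U x -> forall j, `|'J f x i j - 'J f a i j| <= e'.
  apply: radius_forall => i.
  have /cvgrPdist_le /(_ _ e'0) /near_radius[d d0 H] := cf (delta_mx 0 i) a Ua.
  exists d => // x /H; rewrite distrC => K Ux j.
  have L := le_trans (norm_coord_le _ 0 j) K.
  rewrite mxBE in L.
  have aux (u v u' v' : R) :
      u = u' -> v = v' -> `|u' - v'| <= e' -> `|u - v| <= e'.
    by move=> -> ->.
  exact: aux (JE x i j Ux) (JE a i j Ua) L.
exists (Num.min d1 d2) => [|x y]; first by rewrite lt_min d10.
set d := Num.min d1 d2 => xd yd.
have H z : `|z - a| < d -> U z /\ forall i j, `|'J f z i j - 'J f a i j| <= e'.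
  rewrite lt_min => /andP[/H1 Uz /H2 Jz]; split=> // i j; exact: Jz.
have seg (t : R) : 0 <= t <= 1 -> `|y + t *: (x - y) - a| < d.
  exact: segment_in_ball.
apply: norm_mx_le => [|i j]; first by rewrite mulr_ge0// ltW.
rewrite ord1 {i}.
pose phi (t : R) : R := f (y + t *: (x - y)) 0 j.
pose dphi (t : R) : R := ((x - y) *m 'J f (y + t *: (x - y))) 0 j.
have D (t : R) : 0 <= t <= 1 -> is_derive t 1 phi (dphi t).
  by move=> /seg/H[/df ? _]; exact: is_derive_line.
have [t| |t] := @MVT_segment R phi dphi 0 1 ler01.
- by rewrite in_itv /= => /andP[t0 t1]; apply: D; rewrite !ltW.
- apply: derivable_within_continuous => t; rewrite in_itv /= => /D ?.
  exact: ex_derive.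
rewrite in_itv /= => /seg/H[_ Jt]; rewrite /phi /dphi scale1r scale0r addr0 subr0.
rewrite mulr1 (_ : y + (x - y) = x) => [E|]; last by rewrite addrC subrK.
have -> : (f x - f y - (x - y) *m 'J f a) 0 j =
    ((x - y) *m ('J f (y + t *: (x - y)) - 'J f a)) 0 j.
  by rewrite mulmxBr !mxBE E.
rewrite (le_trans (norm_coord_le _ _ _))//.
rewrite (le_trans (@mulmx_norm_le _ _ _ _ e' _ _ (ltW e'0)))//.
  by move=> i k; rewrite mxBE.
rewrite ler_wpM2r// /e' mulrA ler_pdivrMr// mulrC ler_wpM2l ?lerDl//.
exact: ltW.
Qed.

(** * Fibres of submersions of row vectors *)

(** Joins the completeness and the norm of matrices, for the fixed point theorem
    to apply to row vectors. *)
HB.instance Definition _ (R : realType) (m n : nat) :=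
  Complete.copy 'M[R]_(m, n) 'M[R]_(m, n).

(** Banach fixed point theorem on a closed ball around the origin. *)
Lemma contraction_fixed_point (R : realType) n (F : 'rV[R]_n -> 'rV[R]_n) (r : R) :
  0 <= r -> (forall w, `|w| <= r -> `|F w| <= r) ->
  (forall v w, `|v| <= r -> `|w| <= r -> `|F v - F w| <= 2^-1 * `|v - w|) ->
  exists2 w, `|w| <= r & F w = w.
Proof.
move=> r0 FU Fl; pose U : set 'rV[R]_n := [set w | `|w| <= r].
have [G FG] : {G : {fun U >-> U} | F = G} by apply: Pfun => w; exact: FU.
have cU : closed U.
  have -> : U = (fun w : 'rV[R]_n => `|w|) @^-1` [set x | x <= r] by [].
  by apply: closed_comp => [x _|]; [exact: norm_continuous|exact: closed_le].
have ctr : is_contraction G.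
  exists 2^-1%:nng; split => /=; first by rewrite invf_lt1// ltr1n.
  move=> [v w] [/= Uv Uw]; rewrite -FG; exact: Fl.
have [|w Uw wE] := banach_fixed_point ctr cU; first by exists 0; rewrite /U /= normr0.
by exists w => //; rewrite FG -wE.
Qed.

(** Newton iteration with the fixed inverse derivative. The map
    w |-> w - (f (g + w *m B) - y) is a contraction because B *m A = 1 cancels
    the linear part of its increments. *)
Lemma strict_diff_solve (R : realType) m n (f : 'rV[R]_m -> 'rV[R]_n) a A B
    (r : R) :
  strict_diff f a A -> B *m A = 1%:M -> 0 < r ->
  exists2 d : R, 0 < d & forall g y, `|g - a| < d -> `|y - f a| < d ->
    exists2 w, `|w| <= r & f (g + w *m B) = y.
Proof.
move=> fA BA r0.
have [b b0 Bb] := mulmx_bounded B.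
have [C C0 [d2 d20 fC]] := strict_diff_lip fA.
have [d1 d10 fs] := fA (2^-1 / b) ltac:(by rewrite divr_gt0).
(* Keeps g + w *m B within the radius d1 for g in the ball of half that radius. *)
pose rho := Num.min r (d1 / 2 / b).
have rho0 : 0 < rho by rewrite lt_min r0 !divr_gt0.
exists (Num.min (Num.min d2 (d1 / 2)) (Num.min (rho / 4 / C) (rho / 4))).
  by rewrite !lt_min d20 /= !divr_gt0.
move=> g y; rewrite !lt_min => /andP[/andP[gd2 gd1] /andP[gC _]] /andP[_ /andP[_ yr]].
have inb w : `|w| <= rho -> `|g + w *m B - a| < d1.
  move=> wr; rewrite addrAC (le_lt_trans (ler_normD _ _))//.
  rewrite (splitr d1) ltr_leD// (le_trans (Bb _))// mulrC -ler_pdivlMr//.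
  by rewrite (le_trans wr)// ge_min lexx orbT.
pose F w := w - (f (g + w *m B) - y).
(* The increments of F are exactly the errors of the linear approximation. *)
have Fl v w : `|v| <= rho -> `|w| <= rho -> `|F v - F w| <= 2^-1 * `|v - w|.
  move=> vr wr; have := fs _ _ (inb _ vr) (inb _ wr).
  have -> : g + v *m B - (g + w *m B) = (v - w) *m B.
    by rewrite mulmxBl opprD addrACA subrr add0r.
  rewrite -mulmxA BA mulmx1 -normrN => K.
  have -> : F v - F w = - (f (g + v *m B) - f (g + w *m B) - (v - w)).
    by rewrite /F; apply/rowP => i; rewrite !mxE; ring.
  rewrite (le_trans K)// -mulrA ler_pM2l// ler_pdivrMl//.
have F0 : `|F 0| <= rho / 2.
  rewrite /F mul0mx addr0 sub0r normrN.
  have -> : f g - y = (f g - f a) - (y - f a) by rewrite opprB addrA subrK.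
  rewrite (le_trans (ler_normB _ _))//.
  have : `|f g - f a| <= rho / 4.
    rewrite (le_trans (fC _ _ gd2 _))//; first by rewrite subrr normr0.
    by rewrite mulrC -ler_pdivlMr// ltW.
  move: yr; lra.
have [w|w wr wE] := contraction_fixed_point (ltW rho0) _ Fl.
  move=> wr; rewrite -[F w](subrK (F 0)) (le_trans (ler_normD _ _))//.
  have := Fl w 0 wr; rewrite normr0 subr0 => /(_ (ltW rho0)).
  move: F0; lra.
exists w; first by rewrite (le_trans wr)// ge_min lexx.
move: wE; rewrite /F => /eqP; rewrite -subr_eq0 addrAC subrr sub0r oppr_eq0.
by rewrite subr_eq0 => /eqP.
Qed.

(** Applying A to the difference of the two points isolates w - w', up to
    terms controlled by g - g' and by an error that is at most half of
    |w - w'|. *)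
Lemma strict_diff_implicit_le (R : realType) m n (f : 'rV[R]_m -> 'rV[R]_n) a A B :
  strict_diff f a A -> B *m A = 1%:M ->
  exists2 K : R, 0 < K & exists2 d : R, 0 < d & forall g g' w w',
    `|g + w *m B - a| < d -> `|g' + w' *m B - a| < d ->
    `|w - w'| <= K * (`|g - g'| + `|f (g + w *m B) - f (g' + w' *m B)|).
Proof.
move=> fA BA.
have [b b0 Bb] := mulmx_bounded B; have [c c0 Ac] := mulmx_bounded A.
have e0 : 0 < 2^-1 / b by rewrite divr_gt0.
exists (2 * (1 + c + 2^-1 / b)); first by rewrite mulr_gt0// !addr_gt0.
have [d d0 fs] := fA _ e0; exists d => // g g' w w' wd w'd.
have := fs _ _ wd w'd.
set x := g + w *m B; set x' := g' + w' *m B.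
have xx' : x - x' = (g - g') + (w - w') *m B.
  by rewrite mulmxBl opprD addrACA.
have -> : (x - x') *m A = (g - g') *m A + (w - w').
  by rewrite xx' mulmxDl -(mulmxA _ B) BA mulmx1.
set z := f x - f x'; set u := g - g'; set v := w - w' => K.
have : `|v| <= `|z - (u *m A + v)| + `|z| + `|u *m A|.
  have {1}-> : v = - (z - (u *m A + v)) + z - u *m A.
    by apply/rowP => i; rewrite !mxE; ring.
  rewrite (le_trans (ler_normB _ _))// lerD2r (le_trans (ler_normD _ _))//.
  by rewrite normrN.
have : 2^-1 / b * `|x - x'| <= 2^-1 / b * `|u| + 2^-1 * `|v|.
  rewrite -(mulrA _ _ `|u|) -(mulrA _ _ `|x - x'|) -mulrDr ler_pM2l//.
  rewrite ler_pdivrMl// mulrDr mulVKf ?gt_eqF//.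
  by rewrite xx' (le_trans (ler_normD _ _))// lerD2l.
have := Ac u; move: K.
have : 0 <= (c + 2^-1 / b) * `|z| by rewrite mulr_ge0// addr_ge0// ltW.
have := normr_ge0 u.
lra.
Qed.

(** A vector v of the kernel of A is tangent to the fibre of f: correcting
    a + t *: v to a point x of the fibre costs o(t) only. Since h does not change
    from a to x, its derivative in the direction v vanishes. *)
Lemma fibre_const_jacobian (R : realType) m n k (f : 'rV[R]_m -> 'rV[R]_n)
    (h : 'rV[R]_m -> 'rV[R]_k) a A H B (v : 'rV[R]_m) :
  strict_diff f a A -> B *m A = 1%:M -> has_jacobian h a H ->
  (\forall x \near a, f x = f a -> h x = h a) ->
  v *m A = 0 -> v *m H = 0.
Proof.
move=> fA BA hH /near_radius[d1 d10 hf] vA.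
have [b b0 Bb] := mulmx_bounded B; have [c c0 Hc] := mulmx_bounded H.
have [K K0 [d2 d20 est]] := strict_diff_implicit_le fA BA.
pose L := `|v| + b * (K * `|v|) + 1.
have L0 : 0 < L by rewrite ltr_wpDl// addr_ge0// !mulr_ge0// ltW.
apply/eqP; rewrite -normr_le0; apply/ler_addgt0Pr => e e0; rewrite add0r.
pose e1 := e / (L * (b * c + 1)).
have bc0 : 0 < b * c + 1 by rewrite ltr_wpDl// mulr_ge0// ltW.
have e10 : 0 < e1 by rewrite divr_gt0// mulr_gt0.
have [d3 d30 fs] := fA _ e10; have [d4 d40 hs] := hH _ e10.
pose d := Num.min (Num.min d1 d2) (Num.min d3 d4).
have dp : 0 < d by rewrite !lt_min d10 d20 d30.
have r0 : 0 < d / 2 / b by rewrite !divr_gt0.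
have [d5 d50 sol] := strict_diff_solve fA BA r0.
(* So small that a + t *: v and its correction stay within all the radii. *)
pose t := Num.min (d / 2) d5 / (`|v| + 1).
have v1 : 0 < `|v| + 1 by rewrite ltr_wpDl.
have t0 : 0 < t by rewrite divr_gt0// lt_min d50 divr_gt0.
have tv : `|t *: v| < Num.min (d / 2) d5.
  rewrite normrZ gtr0_norm// /t -mulrA -ltr_pdivlMl ?divr_gt0 ?lt_min ?d50 ?divr_gt0//.
  rewrite mulVf ?gt_eqF ?lt_min ?d50 ?divr_gt0//.
  by rewrite ltr_pdivrMl// mulr1 ltrDl.
move: (tv); rewrite lt_min => /andP[tvd tv5].
have [||w wr fw] := sol (a + t *: v) (f a).
- by rewrite addrAC subrr add0r.
- by rewrite subrr normr0.
set x := a + t *: v + w *m B in fw.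
have xa : x - a = t *: v + w *m B by rewrite /x -(addrA a) [a + _]addrC addrK.
have xd : `|x - a| < d.
  rewrite xa (le_lt_trans (ler_normD _ _))// (splitr d) ltr_leD//.
  by rewrite (le_trans (Bb _))// mulrC -ler_pdivlMr.
have : `|x - a| < d by [].
rewrite /d !lt_min => /andP[/andP[xd1 xd2] /andP[xd3 xd4]].
have wK : `|w| <= K * `|v| * t.
  have := est (a + t *: v) a w 0; rewrite mul0mx addr0 subrr normr0 => /(_ xd2 d20).
  rewrite -/x fw subrr normr0 addr0 subr0 addrAC subrr add0r normrZ gtr0_norm//.
  by rewrite -mulrA [t * _]mulrC mulrA.
have xL : `|x - a| <= t * L.
  rewrite xa (le_trans (ler_normD _ _))// normrZ gtr0_norm//.
  have : `|w *m B| <= b * (K * `|v| * t) by rewrite (le_trans (Bb _))// ler_pM2l.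
  rewrite /L; move: t0; lra.
have w_small : `|w| <= e1 * `|x - a|.
  have := fs x a xd3; rewrite subrr normr0 => /(_ d30).
  rewrite fw subrr sub0r normrN xa mulmxDl -scalemxAl vA scaler0 add0r.
  by rewrite -mulmxA BA mulmx1.
have := hs x xd4; rewrite (hf x xd1 fw) subrr sub0r normrN.
rewrite {1}xa mulmxDl -scalemxAl => hx.
have wH : `|w *m B *m H| <= c * (b * `|w|).
  by rewrite (le_trans (Hc _))// ler_pM2l.
have : `|t *: (v *m H)| <= t * e.
  rewrite -[t *: _](addrK (w *m B *m H)) (le_trans (ler_normB _ _))//.
  apply: (@le_trans _ _ (e1 * `|x - a| * (b * c + 1))).
    have : c * (b * `|w|) <= c * (b * (e1 * `|x - a|)) by rewrite !ler_pM2l.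
    lra.
  apply: (@le_trans _ _ (e1 * (t * L) * (b * c + 1))).
    by rewrite ler_pM2r// ler_pM2l.
  by rewrite /e1 le_eqVlt; apply/orP; left; apply/eqP; field; rewrite !gt_eqF.
by rewrite normrZ gtr0_norm// ler_pM2l.
Qed.

(** Paths on [0, 1] are extended by constants to the whole line, so that
    [const_of_small] applies to them without boundary cases. *)
Definition clamp01 (R : realType) (t : R) : R := Num.max 0 (Num.min 1 t).

Lemma clamp01_0 (R : realType) : clamp01 (0 : R) = 0.
Proof. by rewrite /clamp01 min_r ?ler01// maxxx. Qed.

Lemma clamp01_1 (R : realType) : clamp01 (1 : R) = 1.
Proof. by rewrite /clamp01 minxx max_r ?ler01. Qed.

Lemma clamp01_itv (R : realType) (t : R) : 0 <= clamp01 t <= 1.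
Proof.
rewrite /clamp01; case: (lerP 1 t) => [t1|t1].
  by rewrite max_r// lexx ler01.
by case: (lerP 0 t) => [t0|t0]; rewrite ?lexx ?ler01// t0 ltW.
Qed.

Lemma clamp01_lip (R : realType) (s t : R) :
  `|clamp01 s - clamp01 t| <= `|s - t|.
Proof.
rewrite /clamp01; case: (lerP 1 s) => s1; case: (lerP 1 t) => t1;
  rewrite ?(max_r ler01)//.
- by rewrite subrr normr0.
- by case: (lerP 0 t) => t0; rewrite !ger0_norm; lra.
- by case: (lerP 0 s) => s0; rewrite !ler0_norm; lra.
- case: (lerP 0 t) => t0; case: (lerP 0 s) => s0 //.
  + by rewrite !ler0_norm; lra.
  + by rewrite !ger0_norm; lra.
  + by rewrite subrr normr0.
Qed.

(** Two points of the same fibre near a are joined by a path inside the fibre,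
    obtained by correcting the segment between them. Along this path the
    derivative of h factors through that of f, hence is zero. The path is only
    Lipschitz, which is enough. *)
Lemma const_on_fibres (R : realType) m n k (f : 'rV[R]_m -> 'rV[R]_n)
    (h : 'rV[R]_m -> 'rV[R]_k) a A B :
  strict_diff f a A -> B *m A = 1%:M ->
  (\forall x \near a, exists F N, has_jacobian f x F /\ has_jacobian h x (F *m N)) ->
  exists2 d : R, 0 < d & forall x x', `|x - a| < d -> `|x' - a| < d ->
    f x = f x' -> h x = h x'.
Proof.
move=> fA BA /near_radius[d0 d00 fh].
have [b b0 Bb] := mulmx_bounded B.
have [K K0 [d1 d10 est]] := strict_diff_implicit_le fA BA.
have [C C0 [d2 d20 fC]] := strict_diff_lip fA.
pose d := Num.min d0 d1.
have dp : 0 < d by rewrite lt_min d00.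
have r0 : 0 < d / 2 / b by rewrite !divr_gt0.
have [d3 d30 sol] := strict_diff_solve fA BA r0.
exists (Num.min (Num.min (d / 2) d2) (Num.min d3 (d3 / C))).
  by rewrite !lt_min d20 d30 !divr_gt0.
set D := Num.min (Num.min _ _) _ => x x' xD x'D fxx'.
have Dlt z : `|z - a| < D -> [/\ `|z - a| < d / 2, `|z - a| < d2,
    `|z - a| < d3 & `|z - a| < d3 / C].
  by rewrite /D !lt_min => /andP[/andP[? ?] /andP[? ?]].
(* The segment from x to x', and its correction p t to the fibre. *)
pose g t := x + clamp01 t *: (x' - x).
have gD t : `|g t - a| < D by exact: segment_in_ball (clamp01_itv t).
have g_lip s t : `|g s - g t| <= `|s - t| * `|x' - x|.
  rewrite /g opprD addrACA subrr add0r -scalerBl normrZ.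
  by rewrite ler_wpM2r// clamp01_lip.
have /choice[w wP] : forall t : R, exists w,
    `|w| <= d / 2 / b /\ f (g t + w *m B) = f x.
  move=> t; have [_ _ g3 _] := Dlt _ (gD t).
  have [_ x2 _ x3] := Dlt _ xD.
  have [||w wr wE] := sol (g t) (f x) => //; last by exists w.
  rewrite (le_lt_trans (fC _ _ x2 _))//; first by rewrite subrr normr0.
  by rewrite mulrC -ltr_pdivlMr.
pose p t := g t + w t *m B.
have inb z v : `|z - a| < D -> `|v| <= d / 2 / b -> `|z + v *m B - a| < d.
  move=> /Dlt[zd _ _ _] vr; rewrite addrAC (le_lt_trans (ler_normD _ _))//.
  rewrite (splitr d) ltr_leD// (le_trans (Bb _))// mulrC -ler_pdivlMr//.
have pd t : `|p t - a| < d by apply: inb => //; case: (wP t).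
have ltd0 z : `|z - a| < d -> `|z - a| < d0 by rewrite lt_min => /andP[].
have ltd1 z : `|z - a| < d -> `|z - a| < d1 by rewrite lt_min => /andP[].
have fp t : f (p t) = f x by case: (wP t).
have wlip s t : `|w s - w t| <= K * `|g s - g t|.
  have := est _ _ _ _ (ltd1 _ (pd s)) (ltd1 _ (pd t)).
  by rewrite -/(p s) -/(p t) !fp subrr normr0 addr0.
have w_end t z : g t = z -> `|z - a| < D -> f z = f x -> p t = z.
  move=> gt zD fz; suff w0 : w t = 0 by rewrite /p w0 mul0mx addr0.
  have zd : `|z + 0 *m B - a| < d.
    by apply: inb => //; rewrite normr0 ltW.
  have := est (g t) z (w t) 0 (ltd1 _ (pd t)) (ltd1 _ zd).
  rewrite -/(p t) fp mul0mx addr0 gt fz !subrr subr0 !normr0 addr0 mulr0.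
  by rewrite normr_le0 => /eqP.
have p0 : p 0 = x.
  apply: w_end => //; by rewrite /g clamp01_0 scale0r addr0.
have p1 : p 1 = x'.
  apply: w_end => //; by rewrite /g clamp01_1 scale1r addrC subrK.
pose L := (1 + b * K) * `|x' - x| + 1.
have L0 : 0 < L by rewrite ltr_wpDl// mulr_ge0// addr_ge0// mulr_ge0// ltW.
have p_lip s t : `|p s - p t| <= L * `|s - t|.
  have -> : p s - p t = (g s - g t) + (w s - w t) *m B.
    by rewrite mulmxBl /p opprD addrACA.
  have H1 := g_lip s t.
  have H2 : `|(w s - w t) *m B| <= b * (K * (`|s - t| * `|x' - x|)).
    by rewrite (le_trans (Bb _))// ler_pM2l// (le_trans (wlip _ _))// ler_pM2l.
  rewrite (le_trans (ler_normD _ _))// /L.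
  have := normr_ge0 (s - t); lra.
rewrite -p0 -p1; apply/rowP => j.
apply: (const_of_small (phi := fun t => h (p t) 0 j)) => t e e0.
have [F [N [fF hF]]] := fh (p t) (ltd0 _ (pd t)).
have [c' c'0 Nc] := mulmx_bounded N.
have c1 : 0 < 1 + c' by rewrite addr_gt0.
pose e1 := e / ((1 + c') * L).
have e10 : 0 < e1 by rewrite divr_gt0// mulr_gt0.
have [d4 d40 H4] := fF _ e10; have [d5 d50 H5] := hF _ e10.
exists (Num.min d4 d5 / L) => [|s st]; first by rewrite divr_gt0// lt_min d40.
have : `|p s - p t| < Num.min d4 d5.
  by rewrite (le_lt_trans (p_lip _ _))// mulrC -ltr_pdivlMr.
rewrite lt_min => /andP[/H4 {}H4 /H5 {}H5].
rewrite !fp subrr sub0r normrN in H4.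
rewrite -mxBE (le_trans (norm_coord_le _ _ _))//.
rewrite mulmxA in H5.
have := Nc ((p s - p t) *m F).
have := ler_normD (h (p s) - h (p t) - (p s - p t) *m F *m N)
  ((p s - p t) *m F *m N).
rewrite subrK => T1 T2.
apply: (le_trans T1).
apply: (@le_trans _ _ (e1 * `|p s - p t| * (1 + c'))).
  rewrite mulrDr mulr1 lerD// (le_trans T2)// mulrC ler_pM2r//.
apply: (@le_trans _ _ (e1 * (L * `|s - t|) * (1 + c'))).
  by rewrite ler_pM2r// ler_pM2l.
by rewrite /e1 le_eqVlt; apply/orP; left; apply/eqP; field; rewrite !gt_eqF.
Qed.

(** * Charts and local representatives *)

Section Charts.
Variables (R : realType) (n : nat) (X : topologicalType).
Implicit Types (c : chart R X n) (x : X).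

Lemma chart_cod_map c x : chart_dom c x -> chart_cod c (c x).
Proof. by move=> cx; exists x. Qed.

Lemma chart_cod_inv c p : chart_cod c p ->
  chart_dom c (chart_inv c p) /\ c (chart_inv c p) = p.
Proof. by move=> [x cx <-]; rewrite chart_mapK. Qed.

Lemma chart_inj c x y : chart_dom c x -> chart_dom c y -> c x = c y -> x = y.
Proof. by move=> cx cy E; rewrite -(chart_mapK cx) E chart_mapK. Qed.

Lemma chart_inv_near c x (P : X -> Prop) : chart_dom c x ->
  (\forall y \near x, P y) -> \forall p \near c x, P (chart_inv c p).
Proof.
move=> cx xP; have := @chart_inv_continuous _ _ _ c (c x) (chart_cod_map cx).
by apply; rewrite chart_mapK.
Qed.

Lemma chart_cod_near c x : chart_dom c x -> \forall p \near c x, chart_cod c p.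
Proof.
move=> cx; apply: open_nbhs_nbhs; split; first exact: chart_cod_open.
exact: chart_cod_map.
Qed.

Lemma chart_dom_near c x : chart_dom c x -> \forall y \near x, chart_dom c y.
Proof.
by move=> cx; apply: open_nbhs_nbhs; split => //; exact: chart_dom_open.
Qed.

Lemma chart_image_open c (U : set X) : open U -> open (c @` (chart_dom c `&` U)).
Proof.
move=> oU; rewrite openE => _ [x [cx Ux] <-].
have nU : \forall y \near x, U y by exact: open_nbhs_nbhs.
apply: filterS2 (chart_cod_near cx) (chart_inv_near cx nU) => p cp Up.
by have [dp pE] := chart_cod_inv cp; exists (chart_inv c p).
Qed.

End Charts.

Definition local_rep (R : realType) m n (M : topologicalType) (N : topologicalType)
  (c : chart R M m) (c' : chart R N n) (f : M -> N) : 'rV[R]_m -> 'rV[R]_n :=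
  c' \o f \o chart_inv c.

Lemma local_repE (R : realType) m n (M : topologicalType) (N : topologicalType)
  (c : chart R M m) (c' : chart R N n) (f : M -> N) x :
  chart_dom c x -> local_rep c c' f (c x) = c' (f x).
Proof. by move=> cx; rewrite /local_rep /= chart_mapK. Qed.

Lemma local_rep_comp_near (R : realType) m n k (M N P : topologicalType)
    (c : chart R M m) (c' : chart R N n) (c'' : chart R P k)
    (f : M -> N) (g : N -> P) x :
  {for x, continuous f} -> chart_dom c x -> chart_dom c' (f x) ->
  {near c x, local_rep c' c'' g \o local_rep c c' f =1 local_rep c c'' (g \o f)}.
Proof.
move=> fx cx c'x.
have : \forall p \near c x, chart_dom c' (f (chart_inv c p)).
  apply: (@chart_inv_near _ _ _ c x (fun y => chart_dom c' (f y)) cx).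
  by apply: fx; exact: chart_dom_near.
by apply: filterS => p /= Hp; rewrite /local_rep /= chart_mapK.
Qed.

Lemma smooth_transition_strict (R : realType) n (X : topologicalType)
    (c c' : chart R X n) x :
  smooth_transition c c' -> chart_dom c x -> chart_dom c' x ->
  exists A, strict_diff (local_rep c c' id) (c x) A.
Proof.
move=> cc' cx c'x; eexists; apply: smooth_strict_diff cc'.
  exact/chart_image_open/chart_dom_open.
by exists x.
Qed.

Section SmoothMaps.
Variable R : realType.

Lemma atlas_compatible n (M : manifold R n) (c : chart R M n) :
  atlas c -> compatible_chart c.
Proof. by move=> ac c' ac'; split; exact: atlas_smooth. Qed.

Lemma chart_atP n (M : manifold R n) (x : M) :
  atlas (chart_at x) /\ chart_dom (chart_at x) x.
Proof. by rewrite /chart_at; case: cid2. Qed.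

Lemma chart_at_compatible n (M : manifold R n) (x : M) :
  compatible_chart (chart_at x).
Proof. by apply: atlas_compatible; exact: (chart_atP x).1. Qed.

Lemma chart_at_dom n (M : manifold R n) (x : M) : chart_dom (chart_at x) x.
Proof. exact: (chart_atP x).2. Qed.

(** Smoothness is given in the charts of the atlas. Compatible charts, among
    them the foliated ones, are reached by composing with transition maps. *)
Lemma smooth_map_strict m n (M : manifold R m) (N : manifold R n) (f : M -> N)
    (c : chart R M m) (c' : chart R N n) x :
  smooth_map f -> compatible_chart c -> compatible_chart c' ->
  chart_dom c x -> chart_dom c' (f x) ->
  strict_diff (local_rep c c' f) (c x) ('J (local_rep c c' f) (c x)).
Proof.
move=> [cf sf] kc kc' cx c'x.
suff [A fA] : exists A, strict_diff (local_rep c c' f) (c x) A.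
  by rewrite (strict_diff_jacobian fA).
have [ax dx] := chart_atP x; have [ay dy] := chart_atP (f x).
have [A1 H1] := smooth_transition_strict (kc _ ax).1 cx dx.
have [A3 H3] := smooth_transition_strict (kc' _ ay).2 dy c'x.
have [A2 H2] : exists A, strict_diff (local_rep (chart_at x) (chart_at (f x)) f)
    (chart_at x x) A.
  eexists; apply: smooth_strict_diff (sf _ _ ax ay).
    by apply: chart_image_open; apply: open_comp (@chart_dom_open _ _ _ _).
  by exists x.
have H23 : strict_diff (local_rep (chart_at x) c' f) (chart_at x x) (A2 *m A3).
  apply: (@strict_diff_eq _ _ _ (local_rep (chart_at (f x)) c' id \o
     local_rep (chart_at x) (chart_at (f x)) f)).
    by apply: local_rep_comp_near => //; exact: cf.
  by apply: strict_diff_comp => //; rewrite local_repE.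
exists (A1 *m (A2 *m A3)).
have cid : {for x, continuous (@id M)} by [].
apply: (@strict_diff_eq _ _ _
  (local_rep (chart_at x) c' f \o local_rep c (chart_at x) id)).
  exact: (local_rep_comp_near c' f cid cx dx).
by apply: strict_diff_comp => //; rewrite local_repE.
Qed.

Lemma smooth_id n (M : manifold R n) : smooth_map (@id M).
Proof.
by split=> [x|c c' ac ac']; [exact: cvg_id|exact: atlas_smooth].
Qed.

(** Chain rule. With f or g the identity it also describes changes of charts,
    so that the coordinates of tangent vectors need no separate treatment. *)
Lemma jacobian_local_rep_comp m n k (M : manifold R m) (N : manifold R n)
    (P : manifold R k) (f : M -> N) (g : N -> P)
    (c : chart R M m) (c' : chart R N n) (c'' : chart R P k) x :
  smooth_map f -> smooth_map g ->
  compatible_chart c -> compatible_chart c' -> compatible_chart c'' ->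
  chart_dom c x -> chart_dom c' (f x) -> chart_dom c'' (g (f x)) ->
  'J (local_rep c c'' (g \o f)) (c x) =
  'J (local_rep c c' f) (c x) *m 'J (local_rep c' c'' g) (c' (f x)).
Proof.
move=> sf sg kc kc' kc'' cx c'x c''x; apply: strict_diff_jacobian.
apply: strict_diff_eq; first by apply: local_rep_comp_near c'x => //; exact: sf.1.
apply: strict_diff_comp; first exact: smooth_map_strict.
by rewrite local_repE//; exact: smooth_map_strict.
Qed.

Lemma jacobian_local_rep_id n (M : manifold R n) (c : chart R M n) x :
  chart_dom c x -> 'J (local_rep c c id) (c x) = 1%:M.
Proof.
move=> cx; apply: strict_diff_jacobian.
apply: (@strict_diff_eq _ _ _ (fun p => p *m 1%:M)); last exact: strict_diff_mulmx.
apply: filterS (chart_cod_near cx) => p /chart_cod_inv[_ pE].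
by rewrite mulmx1 /local_rep /= pE.
Qed.

Lemma to_coordE n (M : manifold R n) (c : chart R M n) x (v : tangent x) :
  to_coord c v = (v : 'rV_n) *m 'J (local_rep (chart_at x) c id) (chart_at x x).
Proof. exact: jacobianE. Qed.

Lemma of_coordE n (M : manifold R n) (c : chart R M n) (x : M) u :
  of_coord c x u = u *m 'J (local_rep c (chart_at x) id) (c x).
Proof. exact: jacobianE. Qed.

Lemma of_coordK n (M : manifold R n) (c : chart R M n) (x : M) u :
  compatible_chart c -> chart_dom c x -> to_coord c (of_coord c x u) = u.
Proof.
move=> kc cx; rewrite to_coordE of_coordE -mulmxA.
rewrite -(@jacobian_local_rep_comp _ _ _ M M M id id c (chart_at x) c)//.
- by rewrite jacobian_local_rep_id// mulmx1.
- exact: smooth_id.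
- exact: smooth_id.
- exact: chart_at_compatible.
- exact: chart_at_dom.
Qed.

Lemma to_coordK n (M : manifold R n) (c : chart R M n) (x : M) (v : tangent x) :
  compatible_chart c -> chart_dom c x -> of_coord c x (to_coord c v) = v.
Proof.
move=> kc cx; rewrite of_coordE to_coordE -mulmxA.
rewrite -(@jacobian_local_rep_comp _ _ _ M M M id id (chart_at x) c (chart_at x))//.
- by rewrite jacobian_local_rep_id ?mulmx1//; exact: chart_at_dom.
- exact: smooth_id.
- exact: smooth_id.
- exact: chart_at_compatible.
- exact: chart_at_compatible.
- exact: chart_at_dom.
- exact: chart_at_dom.
Qed.

(** Tangent vectors are stored in the preferred chart of their base point,
    which jumps from point to point. In the coordinates of one fixed chart the
    differential becomes the Jacobian of a single local representative. *)
Lemma to_coord_tdiff m n (M : manifold R m) (N : manifold R n) (f : M -> N)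
    (c : chart R M m) (c' : chart R N n) x (v : tangent x) :
  smooth_map f -> compatible_chart c -> compatible_chart c' ->
  chart_dom c x -> chart_dom c' (f x) ->
  to_coord c' (tdiff f v) = to_coord c v *m 'J (local_rep c c' f) (c x).
Proof.
move=> sf kc kc' cx c'x; rewrite !to_coordE /tdiff jacobianE -!mulmxA.
rewrite -(@jacobian_local_rep_comp _ _ _ _ _ _ f id)//.
- rewrite -(@jacobian_local_rep_comp _ _ _ _ _ _ id f)//.
  + exact: smooth_id.
  + exact: chart_at_compatible.
  + exact: chart_at_dom.
- exact: smooth_id.
- exact: chart_at_compatible.
- exact: chart_at_compatible.
- exact: chart_at_dom.
- exact: chart_at_dom.
Qed.

Lemma submersion_right_inverse m n (M : manifold R m) (N : manifold R n)
    (f : M -> N) (c : chart R M m) (c' : chart R N n) x :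
  smooth_map f -> submersion f -> compatible_chart c -> compatible_chart c' ->
  chart_dom c x -> chart_dom c' (f x) ->
  exists B, B *m 'J (local_rep c c' f) (c x) = 1%:M.
Proof.
move=> sf subf kc kc' cx c'x; apply: surjective_right_inverse => v.
have [u uE] := subf x (of_coord c' (f x) v).
by exists (to_coord c u); rewrite -to_coord_tdiff// uE of_coordK.
Qed.

End SmoothMaps.

(** * Arrows move points along the orbits *)

Section Groupoid.
Variables (R : realType) (n m : nat) (M : manifold R n) (G : manifold R m).
Variable gr : lie_groupoid M G.

Lemma to_coord0 k (N : manifold R k) (c : chart R N k) (x : N) :
  @to_coord R k N c x (0 : 'rV[R]_k) = 0.
Proof. by rewrite to_coordE mul0mx. Qed.

(** The base points are only propositionally equal because the groupoid laws
    are equations between points, not conversions. *)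
Lemma to_coord_inj k (N : manifold R k) (c : chart R N k) (x x' : N)
    (v : tangent x) (v' : tangent x') :
  compatible_chart c -> chart_dom c x -> x = x' ->
  to_coord c v = to_coord c v' -> v = v' :> 'rV[R]_k.
Proof.
by move=> kc cx xx'; subst x' => E; rewrite -(to_coordK v kc cx) E to_coordK.
Qed.

Lemma orbit_tangent_unit y e (a : tangent e) :
  e = unit_arrow gr y -> tdiff (src gr) a = 0 :> 'rV[R]_n ->
  orbit_tangent gr y (tdiff (tgt gr) a : 'rV[R]_n).
Proof. by move=> eE a0; subst e; exists a. Qed.

(** Right translation by the inverse k of g maps the source fibre through g to
    the source fibre through the unit at the target of g. It is defined on that
    fibre only, so its differential is taken on the smooth extension phi of the
    multiplication in charts. The identities src (g' k) = src k and
    tgt (g' k) = tgt g' hold along the fibre, and [fibre_const_jacobian] allows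
    one to differentiate them there: the image Y of X is tangent to the source
    fibre and has the same image as X under the target map. *)
Lemma tgt_ker_src (g : G) (X : tangent g) :
  tdiff (src gr) X = 0 :> 'rV[R]_n ->
  orbit_tangent gr (tgt gr g) (tdiff (tgt gr) X).
Proof.
move=> X0; set k := inv_arrow gr g.
have gk : src gr g = tgt gr k by rewrite tgt_inv.
have [c1 [c2 [c3 [W [F [[a1 a2 a3] [g1 k2] [oW Wgk] sF HF]]]]]] := mul_smooth gk.
have kc1 := atlas_compatible a1; have kc3 := atlas_compatible a3.
set q := c2 k in Wgk; pose phi x := F (x, q); set e := Defs.mul gr g k.
have eE : e = unit_arrow gr (tgt gr g) by exact: mul_invr.
have [e3 phig] : chart_dom c3 e /\ c3 e = phi (c1 g) by exact: HF.
have dpair : differentiable (fun x : 'rV[R]_m => (x, q)) (c1 g).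
  by apply: differentiable_pair; [exact: ex_diff|exact: differentiable_cst].
have dphi : has_jacobian phi (c1 g) ('J phi (c1 g)).
  apply: has_jacobian_diff.
  have -> : phi = F \o (fun x => (x, q)) by [].
  by apply: differentiable_comp => //; exact: (sF 1%N).1.
set c0 := chart_at (src gr g); set V := to_coord c1 X.
have ss := src_smooth gr; have st := tgt_smooth gr.
have kat (x : M) := chart_at_compatible x.
have dat (x : M) := chart_at_dom x.
have fA := smooth_map_strict ss kc1 (kat _) g1 (dat (src gr g)).
have [B BA] := submersion_right_inverse ss (@src_submersion _ _ _ _ _ gr)
  kc1 (kat _) g1 (dat (src gr g)).
have V0 : V *m 'J (local_rep c1 c0 (src gr)) (c1 g) = 0.
  by rewrite -(to_coord_tdiff X ss kc1 (kat _) g1 (dat _)) X0 to_coord0.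
have fibre : \forall x \near c1 g,
    local_rep c1 c0 (src gr) x = local_rep c1 c0 (src gr) (c1 g) ->
    [/\ c1 (chart_inv c1 x) = x, src gr (chart_inv c1 x) = src gr g,
        chart_dom c3 (Defs.mul gr (chart_inv c1 x) k) &
        c3 (Defs.mul gr (chart_inv c1 x) k) = phi x].
  have n1 := chart_cod_near g1.
  have n2 : \forall x \near c1 g, chart_dom c0 (src gr (chart_inv c1 x)).
    apply: (@chart_inv_near _ _ _ c1 g (fun y => chart_dom c0 (src gr y)) g1).
    by apply: ss.1; exact: (chart_dom_near (dat _)).
  have n3 : \forall x \near c1 g, W (x, q).
    have cq : {for c1 g, continuous (fun x : 'rV[R]_m => (x, q))}.
      exact: differentiable_continuous.
    by apply: cq; exact: open_nbhs_nbhs.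
  apply: filterS3 n1 n2 n3 => x /chart_cod_inv[d1 xE] d0 Wx.
  rewrite local_repE// /local_rep /= => E.
  have sE : src gr (chart_inv c1 x) = src gr g by apply: (chart_inj d0 (dat _)).
  by have := HF _ k d1 k2 (etrans sE gk); rewrite xE => /(_ Wx)[].
have rep_phi (f : G -> M) (c : chart R M n) : smooth_map f -> compatible_chart c ->
    chart_dom c (f e) ->
    has_jacobian (local_rep c3 c f \o phi) (c1 g)
             ('J phi (c1 g) *m 'J (local_rep c3 c f) (c3 e)).
  move=> sf kc ce; apply: has_jacobian_comp => //; rewrite -phig.
  exact/strict_diff_has_jacobian/smooth_map_strict.
(* The right translate of X, a tangent vector at the unit e. *)
pose Y : tangent e := of_coord c3 e (V *m 'J phi (c1 g)).
have YE : to_coord c3 Y = V *m 'J phi (c1 g) by exact: of_coordK.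
have srcY : tdiff (src gr) Y = 0 :> 'rV[R]_n.
  apply: (to_coord_inj (kat (src gr e)) (dat _) erefl).
  rewrite to_coord0 (to_coord_tdiff Y ss kc3 (kat _) e3 (dat _)) YE -mulmxA.
  apply: (fibre_const_jacobian fA BA (rep_phi _ _ ss (kat _) (dat _)) _ V0).
  apply: filterS fibre => x H E; have [xE sE x3 xphi] := H E.
  rewrite /= -phig -xphi !local_repE// !src_mul// sE.
  by rewrite gk.
have tgte : tgt gr e = tgt gr g by rewrite eE tgt_unit.
set cT := chart_at (tgt gr g).
have eT : chart_dom cT (tgt gr e) by rewrite tgte; exact: dat.
have -> : tdiff (tgt gr) X = tdiff (tgt gr) Y :> 'rV[R]_n.
  apply: (to_coord_inj (kat (tgt gr g)) (dat _) (esym tgte)).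
  rewrite (to_coord_tdiff X st kc1 (kat _) g1 (dat _)).
  rewrite (to_coord_tdiff Y st kc3 (kat _) e3 eT) YE -mulmxA.
  apply/eqP; rewrite eq_sym -subr_eq0 -mulmxBr; apply/eqP.
  apply: (fibre_const_jacobian fA BA
    (has_jacobianB (rep_phi _ cT st (kat _) eT) _) _ V0).
    exact: strict_diff_has_jacobian (smooth_map_strict st kc1 (kat _) g1 (dat _)).
  apply: filterS fibre => x H E; have [xE sE x3 xphi] := H E.
  rewrite /= -phig -xphi !local_repE// !tgt_mul// ?sE//.
  by rewrite /local_rep /= !subrr.
exact: orbit_tangent_unit.
Qed.

End Groupoid.

(** * Transverse coordinates near a unit *)

Lemma pid_mx_coord (R : realType) n p (v : 'rV[R]_n) (i : 'I_n) :
  (v *m (pid_mx p : 'M[R]_n)) 0 i = if (i < p)%N then v 0 i else 0.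
Proof.
rewrite mxE (bigD1 i)//= big1 => [|j ji]; last first.
  by rewrite mxE (inj_eq val_inj) (negPf ji) mulr0.
by rewrite mxE eqxx addr0; case: ifP; rewrite ?mulr1 ?mulr0.
Qed.

(** Projection onto the coordinates of index at least p. The minimum matters
    when p exceeds n, where the diagonal matrices below need a rank at most n. *)
Definition transverse (R : realType) (n p : nat) : 'M[R]_n :=
  copid_mx (minn p n).

Lemma transverse_coord (R : realType) n p (v : 'rV[R]_n) (i : 'I_n) :
  (v *m transverse R n p) 0 i = if (p <= i)%N then v 0 i else 0.
Proof.
rewrite /transverse /copid_mx mulmxBr mulmx1 mxBE pid_mx_coord.
rewrite leq_min ltn_ord andbT ltnNge; case: (leqP p i) => _ /=.
  by rewrite subr0.
by rewrite subrr.
Qed.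

Lemma transverseP (R : realType) n p (v w : 'rV[R]_n) :
  (forall i : 'I_n, (p <= i)%N -> v 0 i = w 0 i) <->
  v *m transverse R n p = w *m transverse R n p.
Proof.
split=> [H|/rowP H i pi].
  by apply/rowP => i; rewrite !transverse_coord; case: ifP => // /H.
by have := H i; rewrite !transverse_coord pi.
Qed.

Section Foliated.
Variables (R : realType) (n m : nat) (M : manifold R n) (G : manifold R m).
Variables (gr : lie_groupoid M G) (p : nat) (c : chart R M n).
Hypothesis fc : foliated_chart (orbit_tangent gr) p c.
Let P := transverse R n p.
Let kc : compatible_chart c. Proof. by case: fc. Qed.
Let ss := src_smooth gr.
Let st := tgt_smooth gr.

Lemma foliated_tangentP x (v : tangent x) : chart_dom c x ->
  orbit_tangent gr x v <-> to_coord c v *m P = 0.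
Proof.
move=> cx; have [_ _ /(_ x cx v) E] := fc.
rewrite -[X in _ = X](mul0mx _ P); split.
  by move=> /E H; apply/transverseP => i /H ->; rewrite mxE.
by move=> /transverseP H; apply/E => i /H ->; rewrite mxE.
Qed.

(** On vectors tangent to a source fibre both Jacobians have zero transverse
    part, the source one trivially and the target one by [tgt_ker_src], and
    [kernel_factor] applies. *)
Lemma transverse_jacobian_factor g (cG : chart R G m) :
  compatible_chart cG -> chart_dom cG g ->
  chart_dom c (src gr g) -> chart_dom c (tgt gr g) ->
  exists N, ('J (local_rep cG c (tgt gr)) (cG g) -
             'J (local_rep cG c (src gr)) (cG g)) *m P =
            'J (local_rep cG c (src gr)) (cG g) *m N.
Proof.
move=> kG gd sd td.
have [B BF] := submersion_right_inverse ss (@src_submersion _ _ _ _ _ gr) kG kc gd sd.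
apply: (kernel_factor BF) => v vF.
pose X : tangent g := of_coord cG g v.
have XE : to_coord cG X = v by exact: of_coordK.
have X0 : tdiff (src gr) X = 0 :> 'rV[R]_n.
  apply: (to_coord_inj kc sd erefl).
  by rewrite to_coord0 (to_coord_tdiff X ss kG kc gd sd) XE.
have := (foliated_tangentP (tdiff (tgt gr) X) td).1 (tgt_ker_src X0).
rewrite (to_coord_tdiff X st kG kc gd td) XE.
exact: mulmx_sub_ker.
Qed.

(** The function h below is constant along source fibres near the unit e at z.
    Each arrow near e lies on the same source fibre as the unit at its source,
    which is near e as well and where h vanishes. *)
Lemma src_tgt_transverse z : chart_dom c z ->
  let cG := chart_at (unit_arrow gr z) in
  exists2 d : R, 0 < d & forall x, `|x - cG (unit_arrow gr z)| < d ->
    [/\ chart_cod cG x, chart_dom c (src gr (chart_inv cG x)),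
        chart_dom c (tgt gr (chart_inv cG x)) &
        local_rep cG c (tgt gr) x *m P = local_rep cG c (src gr) x *m P].
Proof.
move=> cz cG; set e := unit_arrow gr z; set a := cG e.
have ed : chart_dom cG e by exact: chart_at_dom.
have kG : compatible_chart cG by exact: chart_at_compatible.
have se : src gr e = z by exact: src_unit.
have te : tgt gr e = z by exact: tgt_unit.
have sd : chart_dom c (src gr e) by rewrite se.
have td : chart_dom c (tgt gr e) by rewrite te.
have n1 := chart_cod_near ed.
have n2 : \forall x \near a, chart_dom c (src gr (chart_inv cG x)).
  apply: (@chart_inv_near _ _ _ cG e (fun y => chart_dom c (src gr y)) ed).
  by apply: ss.1; exact: (chart_dom_near sd).
have n3 : \forall x \near a, chart_dom c (tgt gr (chart_inv cG x)).
  apply: (@chart_inv_near _ _ _ cG e (fun y => chart_dom c (tgt gr y)) ed).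
  by apply: st.1; exact: (chart_dom_near td).
have fA := smooth_map_strict ss kG kc ed sd.
have [B BA] := submersion_right_inverse ss (@src_submersion _ _ _ _ _ gr) kG kc ed sd.
(* Up to the projection P, the displacement of transverse coordinates. *)
pose h x := (local_rep cG c (tgt gr) x - local_rep cG c (src gr) x) *m P.
have [|d1 d10 H1] := const_on_fibres (h := h) fA BA.
  apply: filterS3 n1 n2 n3 => x /chart_cod_inv[xd xE] sx tx.
  have [N NE] := transverse_jacobian_factor kG xd sx tx.
  rewrite xE in NE.
  exists ('J (local_rep cG c (src gr)) x), N; rewrite -NE.
  have eS : has_jacobian (local_rep cG c (src gr)) x ('J (local_rep cG c (src gr)) x).
    have := smooth_map_strict ss kG kc xd sx.
    by rewrite xE; exact: strict_diff_has_jacobian.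
  have eT : has_jacobian (local_rep cG c (tgt gr)) x ('J (local_rep cG c (tgt gr)) x).
    have := smooth_map_strict st kG kc xd tx.
    by rewrite xE; exact: strict_diff_has_jacobian.
  split=> //.
  have := has_jacobian_comp (has_jacobianB eT eS)
    (strict_diff_has_jacobian (strict_diff_mulmx P _)).
  exact.
have Q0 : \forall y \near e, chart_dom cG y /\ `|cG y - a| < d1.
  have near_cG : \forall y \near e, `|cG y - a| < d1.
    have nb : \forall q \near a, `|q - a| < d1 by apply/near_radius; exists d1.
    exact: (@chart_map_continuous _ _ _ cG e ed _ nb).
  exact: filterS2 (fun y => @conj _ _) (chart_dom_near ed) near_cG.
have Q1 : \forall w \near z, chart_dom cG (unit_arrow gr w) /\
    `|cG (unit_arrow gr w) - a| < d1.
  exact: (unit_smooth gr).1 Q0.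
have Q2 : \forall y \near e, chart_dom cG (unit_arrow gr (src gr y)) /\
    `|cG (unit_arrow gr (src gr y)) - a| < d1.
  by rewrite -se in Q1; exact: (ss.1 e _ Q1).
have n4 := chart_inv_near ed Q2.
have : \forall x \near a, [/\ chart_cod cG x, chart_dom c (src gr (chart_inv cG x)),
        chart_dom c (tgt gr (chart_inv cG x)) &
        chart_dom cG (unit_arrow gr (src gr (chart_inv cG x))) /\
    `|cG (unit_arrow gr (src gr (chart_inv cG x))) - a| < d1].
  by near=> x; split; near: x.
move=> /near_radius[d2 d20 H2].
exists (Num.min d1 d2) => [|x]; first by rewrite lt_min d10.
rewrite lt_min => /andP[xd1 /H2[cx sx tx [ud uda]]]; split=> //.
set y := chart_inv cG x in sx tx ud uda *; set u := unit_arrow gr (src gr y) in ud uda.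
have := H1 x (cG u) xd1 uda; rewrite local_repE// src_unit => /(_ erefl).
rewrite /h !local_repE// src_unit tgt_unit subrr mul0mx => /eqP.
by rewrite mulmxBl subr_eq0 => /eqP.
Unshelve. all: by end_near. Qed.

End Foliated.

(** * Sliding along plaques *)

Section Plaques.
Variables (R : realType) (n m : nat) (M : manifold R n) (G : manifold R m).
Variables (gr : lie_groupoid M G) (p : nat) (c : chart R M n).
Hypothesis fc : foliated_chart (orbit_tangent gr) p c.
Let P := transverse R n p.
Let kc : compatible_chart c. Proof. by case: fc. Qed.
Let ss := src_smooth gr.
Let st := tgt_smooth gr.
Let k := minn p n.
Let Q : 'M[R]_(n, k) := pid_mx k.
Let Q' : 'M[R]_(k, n) := pid_mx k.

Lemma plaque_projections :
  [/\ Q' *m Q = 1%:M, Q *m Q' + P = 1%:M & Q' *m P = 0].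
Proof.
have kn : (k <= n)%N by exact: geq_minr.
split; rewrite /Q /Q'.
- by rewrite pid_mx_id// pid_mx_1.
- by rewrite pid_mx_id// /P /transverse /copid_mx addrC subrK.
- by rewrite mul_pid_mx_copid.
Qed.

Lemma plaque_projections_inj (u v : 'rV[R]_n) :
  u *m Q = v *m Q -> u *m P = v *m P -> u = v.
Proof.
move=> uQ uP; have [_ QQ' _] := plaque_projections.
by rewrite -[u]mulmx1 -[v]mulmx1 -QQ' (mulmxDr u) (mulmxDr v) !mulmxA uQ uP.
Qed.

(** The two functions agree on a whole neighbourhood, so their derivatives
    do. *)
Lemma transverse_jacobians z (cG := chart_at (unit_arrow gr z)) (d : R) :
  (forall x, `|x - cG (unit_arrow gr z)| < d ->
    [/\ chart_cod cG x, chart_dom c (src gr (chart_inv cG x)),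
        chart_dom c (tgt gr (chart_inv cG x)) &
        local_rep cG c (tgt gr) x *m P = local_rep cG c (src gr) x *m P]) ->
  forall x, `|x - cG (unit_arrow gr z)| < d ->
  'J (local_rep cG c (src gr)) x *m P = 'J (local_rep cG c (tgt gr)) x *m P.
Proof.
move=> H x xd; have [/chart_cod_inv[gd xE] sx tx _] := H x xd.
have kG : compatible_chart cG by exact: chart_at_compatible.
have fS := smooth_map_strict ss kG kc gd sx; rewrite xE in fS.
have fT := smooth_map_strict st kG kc gd tx; rewrite xE in fT.
have PS := strict_diff_comp fS (strict_diff_mulmx P _).
have PT := strict_diff_comp fT (strict_diff_mulmx P _).
apply: (strict_diff_unique PS); apply: strict_diff_eq PT; apply/near_radius.
exists (d - `|x - cG (unit_arrow gr z)|) => [|y yx]; first by rewrite subr_gt0.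
have [|_ _ _ //] := H y.
rewrite -(subrK x y) -addrA (le_lt_trans (ler_normD _ _))//.
by rewrite -ltrBrDr.
Qed.

Lemma to_coord_pt (x x' : M) (v : 'rV[R]_n) :
  x = x' -> @to_coord R n M c x v = @to_coord R n M c x' v.
Proof. by move=> ->. Qed.

(** The source map is a submersion, which fixes the first block. The second
    block is then corrected by a vector b tangent to the source fibre: by
    definition the anchor maps such vectors onto the tangent space of the orbit,
    that is onto all vectors with zero transverse coordinates. *)
Lemma src_tgt_right_inverse z (cG := chart_at (unit_arrow gr z))
    (a := cG (unit_arrow gr z)) : chart_dom c z ->
  exists B, B *m row_mx ('J (local_rep cG c (src gr)) a)
                        ('J (local_rep cG c (tgt gr)) a *m Q) = 1%:M.
Proof.
move=> cz; set e := unit_arrow gr z in cG a *.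
have ed : chart_dom cG e by exact: chart_at_dom.
have kG : compatible_chart cG by exact: chart_at_compatible.
have te : tgt gr e = z by exact: tgt_unit.
have sd : chart_dom c (src gr e) by rewrite src_unit.
have td : chart_dom c (tgt gr e) by rewrite te.
set S := 'J (local_rep cG c (src gr)) a; set T := 'J (local_rep cG c (tgt gr)) a.
have [B BS] : exists B, B *m S = 1%:M.
  by exact: (submersion_right_inverse ss (@src_submersion _ _ _ _ _ gr)).
have [Q'Q _ Q'P] := plaque_projections.
apply: surjective_right_inverse => v.
pose u := lsubmx v *m B; pose w := rsubmx v - u *m T *m Q.
have /(foliated_tangentP fc _ cz).2[b b0 bE] :
    to_coord c (of_coord c z (w *m Q')) *m P = 0.
  by rewrite of_coordK// -mulmxA Q'P mulmx0.
have bS : to_coord cG b *m S = 0.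
  rewrite -(to_coord_tdiff b ss kG kc ed sd).
  by rewrite /algebroid /= in b0; rewrite b0 to_coord0.
have bT : to_coord cG b *m T = w *m Q'.
  rewrite -(to_coord_tdiff b st kG kc ed td) (to_coord_pt _ te).
  by rewrite -[tdiff _ _]/(anchor gr z b) bE of_coordK.
exists (u + to_coord cG b).
rewrite mul_mx_row -[RHS](hsubmxK v); congr row_mx.
  by rewrite mulmxDl bS addr0 /u -mulmxA BS mulmx1.
rewrite mulmxA [(u + _) *m T]mulmxDl bT mulmxDl -(mulmxA w) Q'Q mulmx1.
by rewrite /w addrC subrK.
Qed.

(** Solving for the source and the leafwise coordinates of the target gives an
    arrow near the unit. The transverse coordinates of its target are then
    right automatically, since they agree with those of its source. *)
Lemma plaque_arrow z : chart_dom c z ->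
  exists2 d : R, 0 < d & forall y, chart_dom c y -> `|c y - c z| < d ->
    c y *m P = c z *m P ->
    exists g : G, [/\ src gr g = z, tgt gr g = y &
      forall X : tangent g,
        to_coord c (tdiff (src gr) X) *m P = to_coord c (tdiff (tgt gr) X) *m P].
Proof.
move=> cz; have [d1 d10 H1] := src_tgt_transverse fc cz.
have [B BA] := src_tgt_right_inverse cz.
have JP := transverse_jacobians H1; rewrite -/P in H1.
set e := unit_arrow gr z in H1 BA JP; set cG := chart_at e in H1 BA JP.
set a := cG e in H1 BA JP.
have ed : chart_dom cG e by exact: chart_at_dom.
have kG : compatible_chart cG by exact: chart_at_compatible.
have sd : chart_dom c (src gr e) by rewrite src_unit.
have td : chart_dom c (tgt gr e) by rewrite tgt_unit.
have fS := smooth_map_strict ss kG kc ed sd.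
have fT := smooth_map_strict st kG kc ed td.
(* The equation to solve: source z, leafwise coordinates of the target those of y. *)
have fA := strict_diff_row_mx fS (strict_diff_comp fT (strict_diff_mulmx Q _)).
have [b b0 Bb] := mulmx_bounded B.
have [b' b'0 Qb] := mulmx_bounded (row_mx (0 : 'M[R]_n) Q).
have r0 : 0 < d1 / 2 / b by rewrite !divr_gt0.
have [d2 d20 sol] := strict_diff_solve fA BA r0.
exists (d2 / b') => [|y cy yz yP]; first by rewrite divr_gt0.
have [||w wr] := sol a (row_mx (c z) (c y *m Q)).
- by rewrite subrr normr0.
- rewrite /= !local_repE// src_unit tgt_unit opp_row_mx add_row_mx subrr -mulmxBl.
  rewrite -[X in row_mx X _](mulmx0 _ (c y - c z)) -mul_mx_row.
  by rewrite (le_lt_trans (Qb _))// mulrC -ltr_pdivlMr.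
set x := a + w *m B => /eq_row_mx[Sx Tx].
have xd : `|x - a| < d1.
  rewrite /x addrAC subrr add0r (le_lt_trans (Bb _))//.
  rewrite (@le_lt_trans _ _ (d1 / 2))//; first by rewrite mulrC -ler_pdivlMr.
  by rewrite ltr_pdivrMr// mulrDr mulr1 ltrDl.
have [/chart_cod_inv[gd xE] sx tx TS] := H1 x xd.
exists (chart_inv cG x); split.
- exact: (chart_inj sx cz).
- apply: (chart_inj tx cy).
  have TP := etrans TS (etrans (congr1 (mulmx^~ P) Sx) (esym yP)).
  exact: plaque_projections_inj Tx TP.
- move=> X.
  rewrite (to_coord_tdiff X ss kG kc gd sx) (to_coord_tdiff X st kG kc gd tx) xE.
  exact: mulmx_row_eq (JP x xd).
Qed.

Variable eta : riemannian_metric M.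
Hypothesis z0 : zero_metric gr eta.

Definition transverse_rel (x y : M) (v : tangent x) (w : tangent y) : Prop :=
  to_coord c v *m P = to_coord c w *m P.

(** If v and w have the same transverse coordinates then w represents the
    image of v under the normal representation of g: for X over v, the vector
    w - tdiff tgt X has zero transverse coordinates, so it is tangent to the
    orbit. *)
Lemma arrow_isometry x y g : chart_dom c x -> chart_dom c y ->
  src gr g = x -> tgt gr g = y ->
  (forall X : tangent g,
    to_coord c (tdiff (src gr) X) *m P = to_coord c (tdiff (tgt gr) X) *m P) ->
  normal_isometry (orbit_tangent gr) eta (@transverse_rel x y).
Proof.
move=> cx cy gx gy H; subst x y.
have nr (v : tangent (src gr g)) (w : tangent (tgt gr g)) :
    transverse_rel v w -> normal_rep gr g v w.
  move=> vw; have [X XE] := @src_submersion _ _ _ _ _ gr g v.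
  exists X; split=> //; apply/(foliated_tangentP fc _ cy).
  have := vw; rewrite /transverse_rel -XE H !to_coordE => E.
  by apply/eqP; rewrite mulmxBl mulmxBl -E subrr.
move=> v v' w w' vw vw'; apply: (z0 (x0 := src gr g) (g := g)).
- by exists (unit_arrow gr (src gr g)); rewrite /= ?src_unit ?tgt_unit.
- by exists g.
- exact: nr.
- exact: nr.
Qed.

(** The normal metric of vectors with fixed coordinates is locally constant
    along the segment from c x to c y, by [plaque_arrow] and
    [arrow_isometry]. *)
Lemma plaque_isometry x y : chart_dom c x -> chart_dom c y ->
  c x *m P = c y *m P ->
  normal_isometry (orbit_tangent gr) eta (@transverse_rel x y).
Proof.
move=> cx cy xy v v' w w' vw vw'.
have [_ [a [r codE]] _] := fc.
pose D := orbit_tangent gr.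
pose gam (t : R) := c x + clamp01 t *: (c y - c x).
have inball z : chart_dom c z -> `|c z - a| < r.
  move=> /chart_cod_map; rewrite codE -ball_normE /= distrC.
  exact.
have gamP t : chart_dom c (chart_inv c (gam t)) /\ c (chart_inv c (gam t)) = gam t.
  apply: chart_cod_inv; rewrite codE -ball_normE /= distrC.
  by apply: segment_in_ball (clamp01_itv t); exact: inball.
have gam_transverse t : gam t *m P = c x *m P.
  by rewrite /gam mulmxDl -scalemxAl mulmxBl xy subrr scaler0 addr0.
pose q z u u' : R := quotient_metric D eta (of_coord c z u) (of_coord c z u').
have local z : chart_dom c z -> exists2 d : R, 0 < d & forall z', chart_dom c z' ->
    `|c z' - c z| < d -> c z' *m P = c z *m P ->
    normal_isometry D eta (@transverse_rel z z').
  move=> cz; have [d d0 H] := plaque_arrow cz; exists d; first exact: d0.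
  move=> z' cz' zz' zP.
  have [g [gz gz' gX]] := H z' cz' zz' zP.
  exact: (arrow_isometry cz cz' gz gz' gX).
(* Vectors along the segment with the coordinates of v and v'. *)
pose phi t := q (chart_inv c (gam t)) (to_coord c v) (to_coord c v').
have phi_const : forall s t, phi s = phi t.
  apply: const_of_small => t e e0.
  have [ct gt] := gamP t.
  have [d d0 H] := local _ ct.
  have L0 : 0 < `|c y - c x| + 1 by rewrite ltr_wpDl.
  exists (d / (`|c y - c x| + 1)) => [|s st']; first by rewrite divr_gt0.
  have [cs gs] := gamP s.
  rewrite /phi /q (H _ cs _ _ (of_coord c _ (to_coord c v))
    (of_coord c _ (to_coord c v'))).
  - by rewrite subrr normr0 mulr_ge0// ltW.
  - rewrite gs gt /gam opprD addrACA subrr add0r -scalerBl normrZ.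
    rewrite ltr_pdivlMr// in st'; apply: le_lt_trans st'.
    by rewrite ler_pM// ?clamp01_lip// lerDl.
  - by rewrite gs gt !gam_transverse.
  - by rewrite /transverse_rel !of_coordK.
  - by rewrite /transverse_rel !of_coordK.
have phi0 : phi 0 = quotient_metric D eta v v'.
  rewrite /phi /gam clamp01_0 scale0r addr0 chart_mapK// /q.
  by rewrite !to_coordK.
have -> : quotient_metric (orbit_tangent gr) eta v v' = phi 1.
  by rewrite -phi0; exact: phi_const.
have gam1 : gam 1 = c y by rewrite /gam clamp01_1 scale1r addrC subrK.
rewrite /phi gam1 (chart_mapK cy) /q.
have [d d0 H] := local _ cy.
(* Changing representatives within the same point is the case of one point. *)
apply: (H y cy _ erefl); first by rewrite subrr normr0.
- by rewrite /transverse_rel of_coordK.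
- by rewrite /transverse_rel of_coordK.
Qed.

End Plaques.

Theorem proposition3p3 (R : realType) (n m : nat) (M : manifold R n)
    (G : manifold R m) (gr : lie_groupoid M G) (eta : riemannian_metric M) :
  regular gr -> zero_metric gr eta -> bundle_like (orbit_tangent gr) eta.
Proof.
move=> _ z0 x y L; elim=> {x y L} [p c x y fc cx cy xy|x y z K L _ KI _ LI].
  move=> v v' w w' /transverseP vw /transverseP vw'.
  by apply: (plaque_isometry fc z0 cx cy) vw vw'; apply/transverseP.
move=> v v' w w' [u Kvu Luw] [u' Kvu' Luw'].
by rewrite (LI _ _ _ _ Luw Luw') (KI _ _ _ _ Kvu Kvu').
Qed.
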